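(* Let $\beta\in[0,2]$ and $\chi\in(0,1]$. Let $Y_0$ be $\mathbb Z_+$-valued with $\mathbf P(Y_0\ge2)>0$, $\Lambda:=\mathbf E(Y_0^3m^{Y_0})<\infty$ and $(m-1)\mathbf E(Y_0m^{Y_0})=\mathbf E(m^{Y_0})$, and assume the system $(Y_n)$ is $\beta$-regular with coefficient $\chi$. Let $X_0$ be $\mathbb Z_+$-valued with $\mathbf P(X_0=k)\ge\mathbf P(Y_0=k)$ for all integers $k\ge1$, and let $(X_n)$ be the recursive system started from $X_0$. There exists a constant $c_{40}>0$, depending only on $m$ and $\beta$, such that if $\mathbf E(X_0)-\mathbf E(Y_0)\ge\eta$ for some $\eta\in(0,\frac{1}{3(m-1)}]$, then, with $R:=\frac{\Lambda}{\eta\chi\mathbf P(Y_0=0)}$, $$\max_{0\le j\le n_0}\mathbf E(X_j)\ge2,\qquad n_0:=\Big\lfloor\frac{c_{40}}{[\chi^3\mathbf P(Y_0=0)]^{1/2}}\max\{\Lambda(R\log R)^{(1-\beta)/2},(R\log R)^{1/2}\}\log R\Big\rfloor;$$ in particular, the free energy $F^X_\infty$ of $(X_n)$ satisfies $$F_\infty^X\ge\exp\Big[-\frac{c_{41}}{[\chi^3\mathbf P(Y_0=0)]^{1/2}}\max\{\Lambda(R\log R)^{(1-\beta)/2},(R\log R)^{1/2}\}\log R\Big]$$ for a constant $c_{41}>0$ depending only on $m$ and $\beta$.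
   Context: Fix an integer $m\ge2$. Recursive system: $Z_{n+1}$ has the law of $(Z_{n,1}+\cdots+Z_{n,m}-1)^+$ with $Z_{n,i}$ independent copies of $Z_n$. Free energy $F_\infty^X:=\lim_{n\to\infty}\mathbf E(X_n)/m^n$. Regularity: for $\zeta$ $\mathbb Z_+$-valued with $\mathbf E(\zeta m^\zeta)<\infty$, $\mathbf P(\zeta\ge2)>0$, set $\Lambda(\zeta):=\mathbf E(\zeta^3m^\zeta)\in(0,\infty]$, $\Xi_k(\zeta):=\mathbf E[(\zeta\wedge k)^2((m-1)\zeta-1)m^\zeta]$; $\zeta$ (and the system started from it) is $\beta$-regular with coefficient $\chi$ if $\Xi_k(\zeta)\ge\chi\min\{\Lambda(\zeta),k^\beta\}$ for all integers $k\ge1$. *)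

(* Defs.v *)
From Stdlib Require Import Reals Lra Lia ZArith.
Open Scope R_scope.

Definition is_distr (p : nat -> R) : Prop :=
  (forall k, 0 <= p k) /\ infinite_sum p 1.

Definition conv (p q : nat -> R) (n : nat) : R :=
  sum_f_R0 (fun i => p i * q (n - i)%nat) n.

Fixpoint convpow (n : nat) (p : nat -> R) : nat -> R :=
  match n with
  | O => fun k => match k with O => 1 | S _ => 0 end
  | S n' => conv p (convpow n' p)
  end.

(* One step of the recursive system: law of (Z_1 + ... + Z_m - 1)^+ . *)
Definition step (m : nat) (p : nat -> R) (k : nat) : R :=
  let c := convpow m p in
  match k with
  | O => c 0%nat + c 1%nat
  | S k' => c (S (S k'))
  end.

Definition law (m : nat) (p0 : nat -> R) (n : nat) : nat -> R :=
  Nat.iter n (step m) p0.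

Definition Eeq (p : nat -> R) (f : nat -> R) (e : R) : Prop :=
  infinite_sum (fun k => f k * p k) e.

(* E f(X) >= c for nonnegative f, allowing E f(X) = +infinity:
   the supremum of the partial sums is >= c. *)
Definition Ege (p : nat -> R) (f : nat -> R) (c : R) : Prop :=
  forall c', c' < c -> exists N, c' <= sum_f_R0 (fun k => f k * p k) N.

(* Free energy F_infty = lim E(X_n)/m^n  satisfies F_infty >= c
   (stated as liminf >= c; the limit exists in [0,+infinity]). *)
Definition FE_ge (m : nat) (p0 : nat -> R) (c : R) : Prop :=
  forall c', c' < c -> exists N, forall n, (N <= n)%nat ->
    Ege (law m p0 n) INR (c' * INR m ^ n).

Definition Lam_f (m : nat) (k : nat) : R := INR k ^ 3 * INR m ^ k.

Definition Xi_f (m kk : nat) (k : nat) : R :=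
  INR (Nat.min k kk) ^ 2 * ((INR m - 1) * INR k - 1) * INR m ^ k.

Definition regular (m : nat) (p : nat -> R) (Lam beta chi : R) : Prop :=
  forall kk : nat, (1 <= kk)%nat ->
    exists xi, Eeq p (Xi_f m kk) xi /\ xi >= chi * Rmin Lam (Rpower (INR kk) beta).

Definition bound_expr (beta chi p0 Lam Rr : R) : R :=
  / sqrt (chi ^ 3 * p0) *
  Rmax (Lam * Rpower (Rr * ln Rr) ((1 - beta) / 2)) (sqrt (Rr * ln Rr)) * ln Rr.

(* Main.v *)
Require Import Defs.
From Stdlib Require Import Reals ZArith Lra Lia Psatz Classical.
Open Scope R_scope.

(** Laws are handled as positive linear functionals [E] on functions [nat -> R].
    Write [d x = (m - 1) x - 1], [G = E m^X], [D = E (d X m^X)] and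
    [H = E (X (X + 1) d X m^X)].  Then [D] is multiplied by [G^(m-1)] at each step, and while
    [D] is small [H / D] grows only quadratically in time.  Since [G - 1] is at least of order
    [1 / sqrt H], starting from [D] of order [eta] and [H] of order [Lam], [D] reaches a
    constant after [K ~ sqrt (Lam / eta)] steps, at which time the tilted law lives on scale [K].
    From then on replace [m] by [s = m (1 - 1 / (a K))] in [D]: the correction from [(S - 1)^+] is
    favourable for [s < m], so [D(s)] is multiplied by at least [m / s] at each step.  If all
    [E X_j] were below [2] up to time [C K log K], then [E (X_n - j)^+ <= 2 m^-j], which makes
    it harmless to cut off the values above [C K log K] at each step and bounds [D(s)] polynomially
    in [K]; this contradicts the exponential growth.  The perturbation [X_0 - Y_0] may sit on
    large values; the same a priori bound confines half of its mean to values of order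
    [log (1 / eta)], and it is scaled down so that it does not affect the order of [H]. *)

(** * Positive functionals and the recursion *)

(** Every function [nat -> R] is in the domain, unbounded ones included, so no integrability
    condition ever appears. The laws fed in later are the finitely supported [finE]. *)
Record expectation (E : (nat -> R) -> R) : Prop := {
  ev_add : forall f g, E (fun x => f x + g x) = E f + E g;
  ev_scal : forall c f, E (fun x => c * f x) = c * E f;
  ev_le : forall f g, (forall x, f x <= g x) -> E f <= E g;
  ev_one : E (fun _ => 1) = 1 }.

Lemma ev_ext E f g : expectation E -> (forall x, f x = g x) -> E f = E g.
Proof.
  intros H Hfg; apply Rle_antisym; apply (ev_le _ H); intros x; rewrite Hfg; lra.
Qed.

Lemma ev_const E c : expectation E -> E (fun _ => c) = c.
Proof.
  intros H. rewrite (ev_ext _ _ (fun x => c * 1) H) by (intros; ring).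
  rewrite (ev_scal _ H), (ev_one _ H). ring.
Qed.

Definition supported (M : nat) (E : (nat -> R) -> R) : Prop :=
  forall f g, (forall x, (x <= M)%nat -> f x <= g x) -> E f <= E g.

(** Law of a sum of [n] independent copies, written as an iterated expectation so that independence
    is built in. *)
Fixpoint sumE (n : nat) (E : (nat -> R) -> R) (f : nat -> R) : R :=
  match n with
  | O => f 0%nat
  | S n' => E (fun x => sumE n' E (fun y => f (x + y)%nat))
  end.

(** On [nat], [pred] is exactly the map from [S] to [(S - 1)^+]. *)
Definition stepE (m : nat) (E : (nat -> R) -> R) (f : nat -> R) : R :=
  sumE m E (fun x => f (pred x)).

Definition iterE (m n : nat) (E : (nat -> R) -> R) : (nat -> R) -> R :=
  Nat.iter n (stepE m) E.

Lemma sumE_expectation n E : expectation E -> expectation (sumE n E).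
Proof.
  intros H; induction n as [|n IH]; split; simpl; intros; auto.
  - rewrite <- (ev_add _ H). apply (ev_ext _ _ _ H); intros. apply (ev_add _ IH).
  - rewrite <- (ev_scal _ H). apply (ev_ext _ _ _ H); intros. apply (ev_scal _ IH).
  - apply (ev_le _ H); intros. apply (ev_le _ IH); auto.
  - transitivity (E (fun _ => 1)); [|apply (ev_one _ H)]. apply (ev_ext _ _ _ H); intros. apply (ev_one _ IH).
Qed.

Lemma stepE_expectation m E : expectation E -> expectation (stepE m E).
Proof.
  intros H; pose proof (sumE_expectation m E H) as S; unfold stepE; split; intros.
  - apply (ev_add _ S).
  - apply (ev_scal _ S).
  - apply (ev_le _ S); auto.
  - apply (ev_one _ S).
Qed.

Lemma iterE_expectation m n E : expectation E -> expectation (iterE m n E).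
Proof.
  intros H; induction n; simpl; auto. now apply stepE_expectation.
Qed.

Lemma iterE_add m a b E : iterE m (a + b) E = iterE m a (iterE m b E).
Proof. apply Nat.iter_add. Qed.

Lemma sumE_supported n M E : supported M E -> supported (n * M) (sumE n E).
Proof.
  intros H; induction n as [|n IH]; intros f g Hfg; simpl.
  - apply Hfg; lia.
  - apply H; intros x Hx. apply IH; intros y Hy. apply Hfg; simpl; lia.
Qed.

Lemma stepE_supported m M E : supported M E -> supported (m * M) (stepE m E).
Proof.
  intros H f g Hfg. apply (sumE_supported m M E H). intros x Hx; apply Hfg; lia.
Qed.

Lemma iterE_supported m n M E : supported M E -> exists M', supported M' (iterE m n E).
Proof.
  intros H; induction n as [|n [M' IH]]; simpl.
  - now exists M.
  - exists (m * M')%nat. now apply stepE_supported.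
Qed.

(** Stochastic domination of [A] by [B]. *)
Definition below (A B : (nat -> R) -> R) : Prop :=
  forall f, (forall x y, (x <= y)%nat -> f x <= f y) -> A f <= B f.

(** The copies are replaced one at a time: the inner ones for a fixed outer value, then the outer
    one, because the inner expectation is nondecreasing in that value. *)
Lemma sumE_below n A B : expectation A -> expectation B ->
  below A B -> below (sumE n A) (sumE n B).
Proof.
  intros HA HB H; induction n as [|n IH]; intros f Hf; simpl; [lra|].
  apply Rle_trans with (A (fun x => sumE n B (fun y => f (x + y)%nat))).
  - apply (ev_le _ HA); intros x. apply IH; intros; apply Hf; lia.
  - apply H; intros x y Hxy. apply (ev_le _ (sumE_expectation n B HB)).
    intros z; apply Hf; lia.
Qed.

Lemma stepE_below m A B : expectation A -> expectation B ->
  below A B -> below (stepE m A) (stepE m B).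
Proof.
  intros HA HB H f Hf. apply (sumE_below m A B HA HB H). intros; apply Hf; lia.
Qed.

(** * Exponentially weighted moments *)

Definition mom (E : (nat -> R) -> R) (s : R) (j : nat) : R :=
  E (fun x => INR x ^ j * s ^ x).

Lemma ev_poly E s e a0 a1 a2 a3 : expectation E ->
  E (fun x => e + (a0 + a1 * INR x + a2 * INR x ^ 2 + a3 * INR x ^ 3) * s ^ x)
  = e + a0 * mom E s 0 + a1 * mom E s 1 + a2 * mom E s 2 + a3 * mom E s 3.
Proof.
  intros H. unfold mom.
  rewrite <- !(ev_scal _ H).
  rewrite <- (ev_const E e H) at 1.
  rewrite <- !(ev_add _ H).
  apply (ev_ext _ _ _ H); intros; ring.
Qed.

(** Source of the moment inequalities below: each reduces to a pointwise inequality for a cubic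
    times [s ^ x] plus a constant. *)
Lemma mom_ineq E s e a0 a1 a2 a3 : expectation E ->
  (forall x, 0 <= e + (a0 + a1 * INR x + a2 * INR x ^ 2 + a3 * INR x ^ 3) * s ^ x) ->
  0 <= e + a0 * mom E s 0 + a1 * mom E s 1 + a2 * mom E s 2 + a3 * mom E s 3.
Proof.
  intros H Hx. rewrite <- (ev_poly E s e a0 a1 a2 a3 H).
  rewrite <- (ev_const E 0 H) at 1. now apply (ev_le _ H).
Qed.

Lemma ev_poly0 E s a0 a1 a2 a3 f : expectation E ->
  (forall x, f x = (a0 + a1 * INR x + a2 * INR x ^ 2 + a3 * INR x ^ 3) * s ^ x) ->
  E f = a0 * mom E s 0 + a1 * mom E s 1 + a2 * mom E s 2 + a3 * mom E s 3.
Proof.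
  intros H Hf.
  rewrite <- (Rplus_0_l (a0 * mom E s 0)), <- (ev_poly E s 0 a0 a1 a2 a3 H).
  apply (ev_ext _ _ _ H); intros; rewrite Hf; ring.
Qed.

(** Under the tilt by [s ^ X / G] the summands stay independent, with moments [al], [be], [ga];
    these are the usual moments of a sum of [n] independent variables. *)
Lemma mom_sumE E s al be ga n : expectation E ->
  let G := mom E s 0 in
  mom E s 1 = G * al -> mom E s 2 = G * be -> mom E s 3 = G * ga ->
  mom (sumE n E) s 0 = G ^ n /\
  mom (sumE n E) s 1 = G ^ n * (INR n * al) /\
  mom (sumE n E) s 2 = G ^ n * (INR n * be + INR n * (INR n - 1) * al ^ 2) /\
  mom (sumE n E) s 3 = G ^ n * (INR n * ga + 3 * INR n * (INR n - 1) * al * be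
                               + INR n * (INR n - 1) * (INR n - 2) * al ^ 3).
Proof.
  intros H G H1 H2 H3.
  induction n as [|n (I0 & I1 & I2 & I3)].
  - unfold mom; simpl. repeat split; ring.
  - pose proof (sumE_expectation n E H) as HS.
    (* Binomial expansion in the new summand [x]: averaging [(x + y) ^ j] over [y] gives a
       polynomial in [x] with constant term the [j]-th moment and other coefficients [k1], [k2],
       [k3]. *)
    assert (step : forall j b0 b1 b2 b3 k1 k2 k3,
      (forall x y, (x + y) ^ j = b0 x + b1 x * y + b2 x * y ^ 2 + b3 x * y ^ 3) ->
      (forall x, b0 x * mom (sumE n E) s 0 + b1 x * mom (sumE n E) s 1
          + b2 x * mom (sumE n E) s 2 + b3 x * mom (sumE n E) s 3
        = mom (sumE n E) s j + k1 * x + k2 * x ^ 2 + k3 * x ^ 3) ->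
      mom (sumE (S n) E) s j = mom (sumE n E) s j * mom E s 0
         + k1 * mom E s 1 + k2 * mom E s 2 + k3 * mom E s 3).
    { intros j b0 b1 b2 b3 k1 k2 k3 Hxy Hb.
      unfold mom at 1; simpl.
      apply (ev_poly0 E s _ _ _ _ _ H); intros x.
      rewrite <- Hb.
      rewrite (ev_poly0 (sumE n E) s (b0 (INR x) * s ^ x) (b1 (INR x) * s ^ x)
                (b2 (INR x) * s ^ x) (b3 (INR x) * s ^ x) _ HS).
      - ring.
      - intros y. rewrite plus_INR, Hxy, pow_add. ring. }
    rewrite S_INR.
    repeat split.
    + rewrite (step 0%nat (fun _ => 1) (fun _ => 0) (fun _ => 0) (fun _ => 0) 0 0 0).
      * rewrite I0. fold G. simpl. ring.
      * intros; ring.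
      * intros; ring.
    + rewrite (step 1%nat (fun x => x) (fun _ => 1) (fun _ => 0) (fun _ => 0)
                (mom (sumE n E) s 0) 0 0).
      * rewrite I0, I1, H1. fold G. simpl. ring.
      * intros; ring.
      * intros; ring.
    + rewrite (step 2%nat (fun x => x ^ 2) (fun x => 2 * x) (fun _ => 1) (fun _ => 0)
                (2 * mom (sumE n E) s 1) (mom (sumE n E) s 0) 0).
      * rewrite I0, I1, I2, H1, H2. fold G. simpl. ring.
      * intros; ring.
      * intros; ring.
    + rewrite (step 3%nat (fun x => x ^ 3) (fun x => 3 * x ^ 2) (fun x => 3 * x) (fun _ => 1)
                (3 * mom (sumE n E) s 2) (3 * mom (sumE n E) s 1) (mom (sumE n E) s 0)).
      * rewrite I0, I1, I2, I3, H1, H2, H3. fold G. simpl. ring.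
      * intros; ring.
      * intros; ring.
Qed.

(** At [s = m] this is the [D] of the overview, which vanishes at criticality; [defect2] is [H], and
    [defect1] is the intermediate [E (X d X m^X)]. Expressing them through [mom] lets the formulas
    for sums apply directly. *)
Definition defect (m : nat) (E : (nat -> R) -> R) (s : R) : R :=
  (INR m - 1) * mom E s 1 - mom E s 0.

Definition defect1 (m : nat) (E : (nat -> R) -> R) : R :=
  (INR m - 1) * mom E (INR m) 2 - mom E (INR m) 1.

Definition defect2 (m : nat) (E : (nat -> R) -> R) : R :=
  (INR m - 1) * mom E (INR m) 3 + (INR m - 2) * mom E (INR m) 2 - mom E (INR m) 1.

Lemma mom0_ge1 E s : expectation E -> 1 <= s -> 1 <= mom E s 0.
Proof.
  intros H Hs. rewrite <- (ev_one _ H) at 1. apply (ev_le _ H); intros x.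
  simpl. pose proof (pow_R1_Rle s x Hs). lra.
Qed.

Lemma INR_ge2 m : (2 <= m)%nat -> 2 <= INR m.
Proof. intros H. apply le_INR in H. simpl in H. lra. Qed.

Lemma defect_ev m E s : expectation E ->
  defect m E s = E (fun x => ((INR m - 1) * INR x - 1) * s ^ x).
Proof.
  intros H. unfold defect.
  rewrite (ev_poly0 E s (-1) (INR m - 1) 0 0 _ H); [ring | intros; ring].
Qed.

Lemma defect2_ev m E : expectation E ->
  defect2 m E = E (fun x => INR x * (INR x + 1) * ((INR m - 1) * INR x - 1) * INR m ^ x).
Proof.
  intros H. unfold defect2.
  rewrite (ev_poly0 E (INR m) 0 (-1) (INR m - 2) (INR m - 1) _ H); [ring | intros; ring].
Qed.

Lemma mom_step E s m : (2 <= m)%nat -> expectation E -> 1 <= s ->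
  let G := mom E s 0 in
  let al := mom E s 1 / G in let be := mom E s 2 / G in let ga := mom E s 3 / G in
  let n := INR m in
  mom (sumE m E) s 0 = G ^ m /\
  mom (sumE m E) s 1 = G ^ m * (n * al) /\
  mom (sumE m E) s 2 = G ^ m * (n * be + n * (n - 1) * al ^ 2) /\
  mom (sumE m E) s 3 = G ^ m * (n * ga + 3 * n * (n - 1) * al * be
                               + n * (n - 1) * (n - 2) * al ^ 3).
Proof.
  intros Hm H Hs G al be ga n.
  pose proof (mom0_ge1 E s H Hs) as HG; fold G in HG.
  apply (mom_sumE E s al be ga m H); fold G; unfold al, be, ga; field; lra.
Qed.

Lemma pow_pred x m : (2 <= m)%nat -> x ^ m = x * x ^ (m - 1).
Proof. intros H. now replace m with (S (m - 1)) at 1 by lia. Qed.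

(** The right side is the expectation of [d (S - 1) s^(S - 1)], without positive part, so the
    moments of [S] give it exactly. *)
Lemma defect_step_aux m E s : (2 <= m)%nat -> expectation E -> 1 <= s <= INR m ->
  INR m / s * mom E s 0 ^ (m - 1) * defect m E s =
  sumE m E (fun x => ((INR m - 1) * INR x - INR m) / s * s ^ x).
Proof.
  intros Hm H Hs. pose proof (INR_ge2 m Hm) as HM.
  destruct (mom_step E s m Hm H (proj1 Hs)) as (S0 & S1 & _ & _).
  pose proof (mom0_ge1 E s H (proj1 Hs)) as HG.
  pose proof (sumE_expectation m E H) as HS.
  rewrite (ev_poly0 (sumE m E) s (- INR m / s) ((INR m - 1) / s) 0 0 _ HS)
    by (intros; field; lra).
  rewrite S0, S1. unfold defect. rewrite (pow_pred _ m Hm). field; lra.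
Qed.

(** Taking the positive part matters only at [S = 0], where it replaces [- m / s] by [-1]; this is a
    gain because [s <= m], and at [s = m] nothing changes. *)
Lemma defect_step_ge m E s : (2 <= m)%nat -> expectation E -> 1 <= s <= INR m ->
  INR m / s * mom E s 0 ^ (m - 1) * defect m E s <= defect m (stepE m E) s.
Proof.
  intros Hm H Hs. pose proof (INR_ge2 m Hm) as HM.
  rewrite defect_step_aux, defect_ev by auto using stepE_expectation.
  apply (ev_le _ (sumE_expectation m E H)).
  intros [|x].
  - simpl. apply Rmult_le_reg_l with s; [lra|]. field_simplify; lra.
  - simpl Nat.pred. rewrite S_INR. simpl (s ^ S x). apply Req_le. field. lra.
Qed.

Lemma defect_step m E : (2 <= m)%nat -> expectation E ->
  defect m (stepE m E) (INR m) = mom E (INR m) 0 ^ (m - 1) * defect m E (INR m).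
Proof.
  intros Hm H. pose proof (INR_ge2 m Hm) as HM.
  transitivity (INR m / INR m * mom E (INR m) 0 ^ (m - 1) * defect m E (INR m));
    [|field; lra].
  rewrite defect_step_aux, defect_ev by (auto using stepE_expectation; lra).
  apply (ev_ext _ _ _ (sumE_expectation m E H)).
  intros [|x].
  - simpl. field. lra.
  - simpl Nat.pred. rewrite S_INR. simpl (INR m ^ S x). field. lra.
Qed.

(* [x (x + 1) ((m - 1) x - 1)] vanishes at [0] and at [-1], so the truncation in
   [(S - 1)^+] leaves no trace here. *)
Lemma defect2_step m E : (2 <= m)%nat -> expectation E ->
  let M := INR m in
  let G := mom E M 0 in
  let al := mom E M 1 / G in let be := mom E M 2 / G in
  defect2 m (stepE m E) =
  G ^ (m - 1) * (defect2 m E + defect m E M * (2 * (defect1 m E / G)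
     + ((M - 1) * be + (M - 1) * (M - 2) * al ^ 2 - (M - 1) * al))).
Proof.
  intros Hm H M G al be. pose proof (INR_ge2 m Hm) as HM. fold M in HM.
  assert (H1M : 1 <= INR m) by (fold M; lra).
  destruct (mom_step E (INR m) m Hm H H1M) as (S0 & S1 & S2 & S3).
  pose proof (mom0_ge1 E (INR m) H H1M) as HG.
  pose proof (sumE_expectation m E H) as HS.
  rewrite defect2_ev by auto using stepE_expectation.
  transitivity (sumE m E (fun x => INR x * (INR x - 1) * ((M - 1) * INR x - M) / M * M ^ x)).
  - apply (ev_ext _ _ _ HS). intros [|x].
    + simpl. field. lra.
    + simpl Nat.pred. rewrite S_INR. fold M. simpl (M ^ S x). field. lra.
  - rewrite (ev_poly0 (sumE m E) M 0 1 (- (2 * M - 1) / M) ((M - 1) / M) _ HS)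
      by (intros; field; lra).
    unfold M. rewrite S1, S2, S3. unfold defect2, defect1, defect, al, be, G, M.
    rewrite (pow_pred _ m Hm). unfold M in HM. field. lra.
Qed.

(** * Moment inequalities at [s = m] *)

Lemma nat_case3 (P : nat -> Prop) :
  P 0%nat -> P 1%nat -> (forall x, 2 <= INR x -> (2 <= x)%nat -> P x) -> forall x, P x.
Proof.
  intros H0 H1 H2 [|[|x]]; auto. apply H2; [|lia].
  pose proof (pos_INR x). rewrite !S_INR. lra.
Qed.

Section Moments.
Variables (m : nat) (E : (nat -> R) -> R).
Hypotheses (Hm : (2 <= m)%nat) (HE : expectation E).
Let M := INR m.
Let G := mom E M 0.
Let D := defect m E M.

Let HM : 2 <= M. Proof. exact (INR_ge2 m Hm). Qed.

Lemma mom2_le : mom E M 2 <= 2 * defect1 m E + G.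
Proof.
  pose proof (mom_ineq E M 0 1 (-2) (2 * (M - 1) - 1) 0 HE) as Q.
  unfold defect1; fold M.
  enough (0 <= 0 + 1 * mom E M 0 + -2 * mom E M 1 + (2 * (M - 1) - 1) * mom E M 2 + 0 * mom E M 3)
    by (unfold G; lra).
  apply Q. apply nat_case3; simpl; try nra.
  intros x Hx _. pose proof (pow_R1_Rle M x ltac:(lra)).
  rewrite Rplus_0_l. apply Rmult_le_pos; [nra|lra].
Qed.

Lemma defect1_ge0 : 0 <= defect1 m E.
Proof.
  pose proof (mom_ineq E M 0 0 (-1) (M - 1) 0 HE) as Q.
  unfold defect1; fold M.
  enough (0 <= 0 + 0 * mom E M 0 + -1 * mom E M 1 + (M - 1) * mom E M 2 + 0 * mom E M 3)
    by lra.
  apply Q. apply nat_case3; simpl; try nra.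
  intros x Hx _. pose proof (pow_R1_Rle M x ltac:(lra)).
  rewrite Rplus_0_l. apply Rmult_le_pos; [nra|lra].
Qed.

(** Cauchy-Schwarz, by expanding [(X - a)^2] around the tilted mean [a]. *)
Lemma mom1_sq_le : mom E M 1 ^ 2 <= mom E M 2 * G.
Proof.
  assert (HG : 1 <= G) by (apply mom0_ge1; auto; lra).
  pose (a := mom E M 1 / G).
  pose proof (mom_ineq E M 0 (a ^ 2) (-2 * a) 1 0 HE) as Q.
  assert (0 <= 0 + a ^ 2 * mom E M 0 + -2 * a * mom E M 1 + 1 * mom E M 2 + 0 * mom E M 3).
  { apply Q. intros x. pose proof (pow_R1_Rle M x ltac:(lra)).
    rewrite Rplus_0_l. apply Rmult_le_pos; [|lra].
    replace (a ^ 2 + -2 * a * INR x + 1 * INR x ^ 2 + 0 * INR x ^ 3) with ((INR x - a) ^ 2) by ring.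
    apply pow2_ge_0. }
  fold G in H.
  replace (mom E M 1) with (a * G) in * by (unfold a; field; lra). nra.
Qed.

(** Interpolation between [D] and [H] by [2 r X <= r^2 + X^2]. That needs [d X >= 0], which fails
    only at [X = 0]; the extra 1 in [D + 1] compensates there. *)
Lemma defect1_le r : 0 < r -> defect1 m E <= r / 2 * (D + 1) + defect2 m E / (2 * r).
Proof.
  intros Hr.
  pose proof (mom_ineq E M (r / 2) (- (r / 2)) (r / 2 * (M - 1) + 1 - / (2 * r))
    ((M - 2) / (2 * r) - (M - 1)) ((M - 1) / (2 * r)) HE) as Q.
  enough (0 <= r / 2 + - (r / 2) * mom E M 0 +
      (r / 2 * (M - 1) + 1 - / (2 * r)) * mom E M 1 +
      ((M - 2) / (2 * r) - (M - 1)) * mom E M 2 + (M - 1) / (2 * r) * mom E M 3) as Q'.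
  { unfold D, defect, defect1, defect2; fold M.
    match type of Q' with 0 <= ?a =>
      match goal with |- ?l <= ?u => enough (u - l = a) by lra end end.
    field; lra. }
  apply Q. intros x.
  replace (r / 2 + _) with
    (r / 2 * (1 - M ^ x) + INR x * (r / 2 * (M - 1) * M ^ x)
     + INR x * ((M - 1) * INR x - 1) * ((INR x + 1) / (2 * r) - 1) * M ^ x) by (field; lra).
  pose proof (pow_R1_Rle M x ltac:(lra)) as Hp.
  destruct x as [|x].
  - simpl. nra.
  - set (X := INR (S x)).
    assert (HX : 1 <= X) by (unfold X; rewrite S_INR; pose proof (pos_INR x); lra).
    set (p := M ^ S x) in *.
    assert (HD : 0 <= (M - 1) * X - 1) by nra.
    replace (r / 2 * (1 - p) + X * (r / 2 * (M - 1) * p) + X * ((M - 1) * X - 1) * ((X + 1) / (2 * r) - 1) * p)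
      with (r / 2 + ((M - 1) * X - 1) * p * ((r - X) ^ 2 + X) / (2 * r)) by (field; lra).
    assert (0 <= ((M - 1) * X - 1) * p * ((r - X) ^ 2 + X) / (2 * r)); [|lra].
    apply Rle_mult_inv_pos; [|lra].
    apply Rmult_le_pos; [apply Rmult_le_pos; lra|]. pose proof (pow2_ge_0 (r - X)); lra.
Qed.

(** For [1 <= x <= l] use [m^x <= 2 (m^x - 1)]; for [x > l] use [x <= x^3 / l^2]. *)
Lemma mom1_le l : 0 < l -> mom E M 1 <= 2 * l * (G - 1) + mom E M 3 / l ^ 2.
Proof.
  intros Hl.
  pose proof (mom_ineq E M (- (2 * l)) (2 * l) (-1) 0 (/ l ^ 2) HE) as Q.
  enough (0 <= - (2 * l) + 2 * l * mom E M 0 + -1 * mom E M 1 + 0 * mom E M 2 + / l ^ 2 * mom E M 3)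
    by (unfold G, Rdiv; lra).
  apply Q. intros x.
  destruct x as [|x].
  - simpl. lra.
  - set (X := INR (S x)).
    assert (HX : 1 <= X) by (unfold X; rewrite S_INR; pose proof (pos_INR x); lra).
    assert (Hp : 2 <= M ^ S x).
    { simpl. pose proof (pow_R1_Rle M x ltac:(lra)) as Hp. nra. }
    set (p := M ^ S x) in *.
    replace (- (2 * l) + (2 * l + -1 * X + 0 * X ^ 2 + / l ^ 2 * X ^ 3) * p) with
      (l * (p - 2) + p * ((l ^ 3 - X * l ^ 2 + X ^ 3) / l ^ 2)) by (field; lra).
    assert (0 <= (l ^ 3 - X * l ^ 2 + X ^ 3) / l ^ 2).
    { apply Rle_mult_inv_pos; [|nra].
      destruct (Rle_dec X l); [|].
      - assert (0 <= (l - X) * l ^ 2) by nra. assert (0 <= X ^ 3) by (apply pow_le; lra). lra.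
      - assert (0 <= X * ((X - l) * (X + l))) by (repeat apply Rmult_le_pos; lra).
        assert (0 < l ^ 3) by (apply pow_lt; lra). nra. }
    nra.
Qed.

Lemma mom3_le : mom E M 3 <= defect2 m E + mom E M 1.
Proof.
  pose proof (mom_ineq E M 0 0 0 (M - 2) (M - 2) HE) as Q.
  unfold defect2; fold M.
  enough (0 <= 0 + 0 * mom E M 0 + 0 * mom E M 1 + (M - 2) * mom E M 2 + (M - 2) * mom E M 3)
    by lra.
  apply Q. intros x. pose proof (pos_INR x). pose proof (pow_le M x ltac:(lra)).
  rewrite Rplus_0_l. apply Rmult_le_pos; [|lra].
  replace (0 + 0 * INR x + (M - 2) * INR x ^ 2 + (M - 2) * INR x ^ 3) with
    ((M - 2) * (INR x ^ 2 * (1 + INR x))) by ring.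
  apply Rmult_le_pos; [lra|]. nra.
Qed.

(** [2 m^x] exceeds [(m - 1) x m^x] only for [x] in [{0, 1}], and there the constant [M + 1]
    pays. *)
Lemma mom0_le : G <= M + 1 + D.
Proof.
  pose proof (mom_ineq E M (M + 1) (-2) (M - 1) 0 0 HE) as Q.
  unfold D, G, defect; fold M.
  enough (0 <= M + 1 + -2 * mom E M 0 + (M - 1) * mom E M 1 + 0 * mom E M 2 + 0 * mom E M 3)
    by lra.
  apply Q. apply nat_case3; simpl; try nra.
  intros x Hx _. pose proof (pow_R1_Rle M x ltac:(lra)).
  assert (0 <= (-2 + (M - 1) * INR x)) by nra.
  replace (-2 + _ + _ + _) with (-2 + (M - 1) * INR x) by ring.
  nra.
Qed.

(** [D] is multiplied by the same power of [G], so [H / D] increases by at most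
    [2 m^2 (defect1 + 1)]. The second tilted moment is controlled by [defect1], and the squared
    tilted mean by the second moment. *)
Lemma defect2_step_le : 0 <= D ->
  defect2 m (stepE m E) <= G ^ (m - 1) * (defect2 m E + 2 * M ^ 2 * D * (defect1 m E + 1)).
Proof.
  intros HD.
  assert (HG : 1 <= G) by (apply mom0_ge1; auto; lra).
  rewrite defect2_step by auto. fold M G D.
  apply Rmult_le_compat_l; [apply pow_le; lra|]. apply Rplus_le_compat_l.
  set (e := defect1 m E / G).
  pose proof defect1_ge0 as He0.
  assert (He : 0 <= e <= defect1 m E).
  { unfold e; split; [apply Rle_mult_inv_pos; lra|].
    apply Rmult_le_reg_r with G; [lra|]. unfold Rdiv.
    rewrite Rmult_assoc, Rinv_l, Rmult_1_r by lra. nra. }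
  set (be := mom E M 2 / G). set (al := mom E M 1 / G).
  assert (Hbe : be <= 2 * e + 1).
  { unfold be, e. apply Rmult_le_reg_r with G; [lra|].
    replace ((2 * (defect1 m E / G) + 1) * G) with (2 * defect1 m E + G) by (field; lra).
    unfold Rdiv. rewrite Rmult_assoc, Rinv_l, Rmult_1_r by lra. apply mom2_le. }
  assert (Hal : al ^ 2 <= be).
  { unfold al, be. apply Rmult_le_reg_r with (G * G); [nra|].
    replace ((mom E M 1 / G) ^ 2 * (G * G)) with (mom E M 1 ^ 2) by (field; lra).
    replace (mom E M 2 / G * (G * G)) with (mom E M 2 * G) by (field; lra).
    apply mom1_sq_le. }
  assert (Hal0 : 0 <= al).
  { unfold al. apply Rle_mult_inv_pos; [|lra].
    unfold mom. rewrite <- (ev_const E 0 HE). apply (ev_le _ HE); intros x.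
    apply Rmult_le_pos; apply pow_le; [apply pos_INR|lra]. }
  replace (2 * M ^ 2 * D * (defect1 m E + 1)) with (D * (2 * M ^ 2 * (defect1 m E + 1))) by ring.
  apply Rmult_le_compat_l; [lra|].
  assert ((M - 1) * (M - 2) * al ^ 2 <= (M - 1) * (M - 2) * be).
  { apply Rmult_le_compat_l; [nra|lra]. }
  assert (0 <= (M - 1) * al) by nra.
  assert ((M - 1) ^ 2 * be <= (M - 1) ^ 2 * (2 * defect1 m E + 1)).
  { apply Rmult_le_compat_l; [nra|lra]. }
  assert (0 <= M * defect1 m E) by nra. nra.
Qed.

(** The first moment is at least [1 / (m - 1)] and the third at most of order [r^2 D]. With [l] of
    order [r d] the cubic term of [mom1_le] takes at most half of the first moment, so [G - 1] is at
    least of order [1 / l]. *)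
Lemma mom0_growth r d : 0 < r -> 0 < d -> D = d ^ 2 -> D <= 1 -> 1 <= r ^ 2 * D ->
  defect2 m E <= r ^ 2 * D ->
  / (8 * (M - 1) * (M + 4)) / (r * d) <= G - 1.
Proof.
  intros Hr Hd HD HD1 HrD HH.
  pose proof mom0_le as HG0. pose proof mom3_le as HT.
  assert (HG : 1 <= G) by (apply mom0_ge1; auto; lra).
  assert (HA : (M - 1) * mom E M 1 = D + G) by (unfold D, G, defect; fold M; ring).
  assert (HA1 : mom E M 1 <= D + G) by nra.
  assert (HA2 : / (M - 1) <= mom E M 1).
  { apply Rmult_le_reg_l with (M - 1); [lra|]. rewrite Rinv_r, HA by lra. nra. }
  assert (HrM : 0 <= (r ^ 2 * D - 1) * (M + 3)) by (apply Rmult_le_pos; lra).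
  assert (HT2 : mom E M 3 <= (M + 4) * (r ^ 2 * D)) by nra.
  set (l := 2 * (M + 4) * (r * d)).
  assert (Hrd : 0 < r * d) by (apply Rmult_lt_0_compat; lra).
  assert (Hl : 0 < l) by (unfold l; nra).
  pose proof (mom1_le l Hl) as Q.
  assert (HTl : mom E M 3 / l ^ 2 <= / (4 * (M + 4))).
  { apply Rmult_le_reg_r with (l ^ 2); [nra|].
    unfold Rdiv. rewrite Rmult_assoc, Rinv_l, Rmult_1_r by nra.
    replace (/ (4 * (M + 4)) * l ^ 2) with ((M + 4) * (r ^ 2 * d ^ 2)) by (unfold l; field; lra).
    rewrite <- HD. lra. }
  assert (H2 : / (4 * (M + 4)) <= / 2 * / (M - 1)).
  { rewrite <- Rinv_mult. apply Rinv_le_contravar; lra. }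
  assert (H3 : / 2 * / (M - 1) <= 2 * l * (G - 1)) by lra.
  apply Rmult_le_reg_l with (2 * l); [lra|].
  replace (2 * l * _) with (/ 2 * / (M - 1)) by (unfold l; field; repeat split; lra).
  exact H3.
Qed.

End Moments.

(** * Growth of the defect to constant order *)

Lemma exists_ceil x : 0 <= x -> exists n, x <= INR n <= x + 1.
Proof.
  intros Hx. destruct (archimed x) as [H1 H2].
  exists (Z.to_nat (up x)). rewrite INR_IZR_INZ, Z2Nat.id; [lra|].
  apply le_IZR. lra.
Qed.

(** If [H <= r^2 D] and [D <= 1], then [defect1 <= 3 r / 2], and one step replaces [r] by
    [r + drift]. Over at most [K + 1 <= 2 K] steps a radius starting at [K] stays below
    [spread * K]; [rate] is the resulting speed of [sqrt D], up to the factor [1 / K]. *)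
Definition drift (m : nat) : R := 2 * INR m ^ 2.
Definition spread (m : nat) : R := 1 + 2 * drift m.
Definition rate (m : nat) : R := / (8 * (INR m - 1) * (INR m + 4)) / (3 * spread m).

Lemma rate_bounds m : (2 <= m)%nat -> 0 < rate m <= 1.
Proof.
  intros Hm. pose proof (INR_ge2 m Hm). unfold rate, spread, drift.
  assert (0 < (INR m - 1) * (INR m + 4)) by nra.
  unfold Rdiv. rewrite <- Rinv_mult. split.
  - apply Rinv_0_lt_compat. apply Rmult_lt_0_compat; nra.
  - rewrite <- Rinv_1. apply Rinv_le_contravar; nra.
Qed.

(* [sqrt (D_n)] grows by [rate / K] per step while [H_n / D_n] stays below [(K + drift * n)^2]. *)
Lemma escape m E K : (2 <= m)%nat -> expectation E -> 1 <= K ->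
  0 < defect m E (INR m) -> 1 <= K ^ 2 * defect m E (INR m) ->
  defect2 m E <= K ^ 2 * defect m E (INR m) ->
  exists n, INR n <= K + 1 /\
    rate m ^ 2 <= defect m (iterE m n E) (INR m) /\
    defect2 m (iterE m n E) <= (spread m * K) ^ 2 * defect m (iterE m n E) (INR m).
Proof.
  intros Hm HE HK HD0 HKD HH0.
  pose proof (INR_ge2 m Hm) as HM. pose proof (rate_bounds m Hm) as Hc.
  set (M := INR m) in *. set (c := rate m) in *.
  set (D0 := defect m E M) in *.
  assert (HC : 2 <= drift m) by (unfold drift; fold M; nra).
  set (C := drift m) in *.
  destruct (exists_ceil K) as [N HN]; [lra|].
  (* By contradiction: if no time up to [N] works, [D] stays below [rate^2], yet the growth of
     [sqrt D] brings it to [rate] by time [N >= K]. *)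
  apply NNPP; intros Hno.
  assert (Hsp : forall n, (n <= N)%nat -> K + C * INR n <= spread m * K).
  { intros n Hn. apply le_INR in Hn. unfold spread; fold C. nra. }
  assert (inv : forall n, (n <= N)%nat ->
    defect2 m (iterE m n E) <= (K + C * INR n) ^ 2 * defect m (iterE m n E) M /\
    D0 <= defect m (iterE m n E) M /\
    exists d, 0 < d /\ defect m (iterE m n E) M = d ^ 2 /\ c * INR n / K <= d).
  { induction n as [|n IH]; intros Hn.
    - change (iterE m 0 E) with E. change (INR 0) with 0. split; [|split].
      + rewrite Rmult_0_r, Rplus_0_r. exact HH0.
      + unfold D0; lra.
      + exists (sqrt D0). split; [now apply sqrt_lt_R0|]. split.
        * rewrite pow2_sqrt; unfold D0 in *; lra.
        * unfold Rdiv. rewrite Rmult_0_r, Rmult_0_l. apply sqrt_pos.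
    - destruct IH as (I1 & I2 & d & Hd & HDd & Hcd); [lia|].
      pose proof (iterE_expectation m n E HE) as HF.
      change (iterE m (S n) E) with (stepE m (iterE m n E)).
      set (F := iterE m n E) in *.
      specialize (Hsp n ltac:(lia)).
      assert (HCn : 0 <= C * INR n) by (apply Rmult_le_pos; [lra | apply pos_INR]).
      assert (Hr : 0 < K + C * INR n) by lra.
      assert (Hr1 : K <= K + C * INR n) by lra.
      replace (K + C * INR (S n)) with ((K + C * INR n) + C) by (rewrite S_INR; ring).
      set (r := K + C * INR n) in *.
      set (D := defect m F M) in *.
      assert (HDlt : D < c ^ 2).
      { apply Rnot_le_lt; intros Hge. apply Hno. exists n. fold F D.
        apply le_INR in Hn. rewrite S_INR in Hn.
        split; [lra|]. split; [exact Hge|].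
        apply Rle_trans with (1 := I1). apply Rmult_le_compat_r; [lra|].
        apply pow_incr; lra. }
      assert (HD1 : D <= 1) by nra.
      assert (HDpos : 0 < D) by lra.
      assert (HKr : K ^ 2 <= r ^ 2) by (apply pow_incr; lra).
      assert (HrD : 1 <= r ^ 2 * D).
      { apply Rle_trans with (1 := HKD). apply Rmult_le_compat; try nra. }
      assert (Hstep : defect m (stepE m F) M = mom F M 0 ^ (m - 1) * D) by (apply defect_step; auto).
      pose proof (mom0_growth m F Hm HF r d Hr Hd HDd HD1 HrD I1) as Hg.
      fold M in Hg.
      assert (HG : 1 <= mom F M 0) by (apply mom0_ge1; auto; lra).
      set (G := mom F M 0) in *.
      assert (HGm : G <= G ^ (m - 1)).
      { replace (m - 1)%nat with (S (m - 2)) by lia. simpl.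
        pose proof (pow_R1_Rle G (m - 2) HG). nra. }
      (* The factor 3 makes the left side at least [(d + c / K)^2], given [c / K <= d]; the latter
         follows from [1 <= K d] and [c <= 1]. *)
      assert (Hgrow : d ^ 2 + 3 * c / K * d <= defect m (stepE m F) M).
      { rewrite Hstep.
        assert (3 * c / K <= (G - 1) * d).
        { apply Rle_trans with (/ (8 * (M - 1) * (M + 4)) / (r * d) * d); [|nra].
          replace (/ (8 * (M - 1) * (M + 4)) / (r * d) * d) with
            (/ (8 * (M - 1) * (M + 4)) * / r) by (field; repeat split; lra).
          assert (Hs : 1 <= spread m) by (unfold spread; fold C; lra).
          unfold c, rate; fold M.
          replace (3 * (/ (8 * (M - 1) * (M + 4)) / (3 * spread m)) / K) with
            (/ (8 * (M - 1) * (M + 4)) * / (spread m * K)) by (field; repeat split; lra).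
          apply Rmult_le_compat_l.
          - left; apply Rinv_0_lt_compat. nra.
          - apply Rinv_le_contravar; lra. }
        assert (G * D <= G ^ (m - 1) * D) by (apply Rmult_le_compat_r; lra).
        assert (3 * c / K * d <= (G - 1) * d * d) by (apply Rmult_le_compat_r; lra).
        nra. }
      assert (HcK : 0 < c / K) by (apply Rdiv_lt_0_compat; lra).
      split; [|split].
      + pose proof (defect2_step_le m F Hm HF) as Hs2.
        fold M D G in Hs2. specialize (Hs2 ltac:(lra)).
        apply Rle_trans with (1 := Hs2). rewrite Hstep.
        replace ((r + C) ^ 2 * (G ^ (m - 1) * D)) with (G ^ (m - 1) * ((r + C) ^ 2 * D)) by ring.
        apply Rmult_le_compat_l; [lra|].
        pose proof (defect1_le m F Hm HF r Hr) as HE1. fold M D in HE1.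
        assert (defect2 m F / (2 * r) <= r / 2 * D).
        { apply Rmult_le_reg_r with (2 * r); [lra|].
          unfold Rdiv at 1. rewrite Rmult_assoc, Rinv_l by lra. nra. }
        assert (HE2 : defect1 m F <= 3 / 2 * r) by nra.
        change (2 * M ^ 2) with C.
        assert (C * D * (defect1 m F + 1) <= C * D * (3 / 2 * r + 1)).
        { apply Rmult_le_compat_l; [apply Rmult_le_pos; lra | lra]. }
        assert (HCD : 0 <= C * D) by (apply Rmult_le_pos; lra).
        assert (0 <= C * D * r) by (apply Rmult_le_pos; lra).
        assert (0 <= C * D * (C - 1)) by (apply Rmult_le_pos; lra).
        nra.
      + apply Rle_trans with (1 := I2).
        assert (0 <= 3 * c / K * d) by nra. lra.
      + exists (sqrt (defect m (stepE m F) M)).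
        assert (Hpos : 0 < defect m (stepE m F) M) by nra.
        split; [now apply sqrt_lt_R0|]. split; [rewrite pow2_sqrt; lra|].
        apply Rle_trans with (d + c / K).
        * rewrite S_INR. apply Rle_trans with (c * INR n / K + c / K); [|lra].
          apply Req_le. field. lra.
        * rewrite <- (sqrt_pow2 (d + c / K)) by lra. apply sqrt_le_1_alt.
          apply Rle_trans with (2 := Hgrow).
          assert (HdK : 1 <= K * d).
          { apply Rnot_lt_le; intros Hlt.
            assert (0 < K * d) by nra.
            assert (K ^ 2 * D0 <= (K * d) ^ 2) by nra. nra. }
          assert (c / K <= d).
          { apply Rmult_le_reg_r with K; [lra|]. unfold Rdiv.
            rewrite Rmult_assoc, Rinv_l by lra. lra. }
          replace (3 * c / K * d) with (3 * (c / K) * d) by (field; lra). nra. }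
  destruct (inv N) as (I1 & I2 & d & Hd & HDd & Hcd); [lia|].
  apply Hno. exists N. split; [lra|]. split.
  - rewrite HDd. apply pow_incr. split; [lra|].
    apply Rle_trans with (2 := Hcd). apply Rmult_le_reg_r with K; [lra|].
    unfold Rdiv. rewrite Rmult_assoc, Rinv_l by lra. nra.
  - apply Rle_trans with (1 := I1). apply Rmult_le_compat_r; [lra|].
    apply pow_incr; split; [|apply Hsp; lia]. pose proof (pos_INR N); nra.
Qed.

(** * Exponential growth of the cut-off defect *)

Lemma ev_sum E g N : expectation E ->
  E (fun x => sum_f_R0 (fun j => g j x) N) = sum_f_R0 (fun j => E (g j)) N.
Proof.
  intros H; induction N as [|N IH]; simpl.
  - apply (ev_ext _ _ _ H); auto.
  - rewrite <- IH, <- (ev_add _ H). apply (ev_ext _ _ _ H); auto.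
Qed.

Lemma sumE_superadditive n E f : expectation E -> 0 <= f 0%nat ->
  (forall x y, f x + f y <= f (x + y)%nat) -> INR n * E f <= sumE n E f.
Proof.
  intros H H0 Hf; induction n as [|n IH]; simpl sumE.
  - simpl. lra.
  - rewrite S_INR. apply Rle_trans with (E (fun x => f x + sumE n E f)).
    + rewrite (ev_add _ H), (ev_const E _ H). lra.
    + apply (ev_le _ H); intros x.
      pose proof (sumE_expectation n E H) as HS.
      rewrite <- (ev_const (sumE n E) (f x) HS) at 1.
      rewrite <- (ev_add _ HS). apply (ev_le _ HS). auto.
Qed.

(** The map from [x] to [(x - (j + 1))^+] vanishes at 0 and is superadditive, and subtracting 1 and
    then [j] is subtracting [j + 1]. *)
Lemma stepE_excess m E j : expectation E ->
  INR m * E (fun x => INR (x - S j)) <= stepE m E (fun x => INR (x - j)).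
Proof.
  intros H. unfold stepE.
  apply Rle_trans with (sumE m E (fun x => INR (x - S j))).
  - apply (sumE_superadditive m E (fun x => INR (x - S j)) H); simpl; [lra|].
    intros x y. rewrite <- plus_INR. apply le_INR. lia.
  - apply (ev_le _ (sumE_expectation m E H)); intros x. apply le_INR. lia.
Qed.

Lemma iterE_excess m E j i : expectation E ->
  INR m ^ j * E (fun x => INR (x - (i + j))) <= iterE m j E (fun x => INR (x - i)).
Proof.
  intros H. revert i. induction j as [|j IH]; intros i.
  - simpl. rewrite Rmult_1_l. apply (ev_le _ H); intros x. apply le_INR; lia.
  - pose proof (iterE_expectation m j E H) as HF.
    change (iterE m (S j) E) with (stepE m (iterE m j E)).
    apply Rle_trans with (2 := stepE_excess m _ i HF).
    simpl pow. rewrite Rmult_assoc. apply Rmult_le_compat_l; [apply pos_INR|].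
    specialize (IH (S i)). rewrite Nat.add_succ_comm in IH. exact IH.
Qed.

(** The a priori bound: as long as [E X_j < 2], the excess of the initial law over [j] is at most
    [2 m^-j]. *)
Lemma iterE_mean m E j : expectation E ->
  INR m ^ j * E (fun x => INR (x - j)) <= iterE m j E INR.
Proof.
  intros H. apply Rle_trans with (1 := iterE_excess m E j 0 H).
  apply (ev_le _ (iterE_expectation m j E H)); intros x. apply le_INR; lia.
Qed.

(** * Truncation of the values at a level [J] *)

Definition cut (J x : nat) : nat := if (x <=? J)%nat then x else 0%nat.

Definition cutE (J : nat) (E : (nat -> R) -> R) (f : nat -> R) : R := E (fun x => f (cut J x)).

(** The cut is made at time 0 and after every step. Large values are sent to 0, which keeps the
    total mass and only lowers the law stochastically. *)
Definition cutiterE (m J k : nat) (E : (nat -> R) -> R) : (nat -> R) -> R :=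
  Nat.iter k (fun F => cutE J (stepE m F)) (cutE J E).

Lemma cut_le J x : (cut J x <= J /\ cut J x <= x)%nat.
Proof. unfold cut. destruct (Nat.leb_spec x J); lia. Qed.

Lemma cutE_expectation J E : expectation E -> expectation (cutE J E).
Proof.
  intros H; unfold cutE; split; intros.
  - apply (ev_add _ H).
  - apply (ev_scal _ H).
  - apply (ev_le _ H); auto.
  - apply (ev_one _ H).
Qed.

Lemma cutE_supported J E : expectation E -> supported J (cutE J E).
Proof.
  intros H f g Hfg. apply (ev_le _ H); intros x. apply Hfg, cut_le.
Qed.

Lemma cutE_below J A B : expectation A -> below A B -> below (cutE J A) B.
Proof.
  intros HA H f Hf. apply Rle_trans with (2 := H f Hf).
  apply (ev_le _ HA); intros x. apply Hf, cut_le.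
Qed.

Lemma cutiterE_spec m J k E : expectation E ->
  expectation (cutiterE m J k E) /\ supported J (cutiterE m J k E) /\
  below (cutiterE m J k E) (iterE m k E).
Proof.
  intros H; induction k as [|k (I1 & I2 & I3)].
  - split; [|split].
    + now apply cutE_expectation.
    + now apply cutE_supported.
    + apply cutE_below; auto. intros f _; apply Rle_refl.
  - change (cutiterE m J (S k) E) with (cutE J (stepE m (cutiterE m J k E))).
    change (iterE m (S k) E) with (stepE m (iterE m k E)).
    pose proof (stepE_expectation m _ I1) as I1'.
    split; [|split].
    + now apply cutE_expectation.
    + now apply cutE_supported.
    + apply cutE_below; auto. apply stepE_below; auto. now apply iterE_expectation.
Qed.

Lemma sum_ge_term f N j : (forall i, 0 <= f i) -> (j <= N)%nat -> f j <= sum_f_R0 f N.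
Proof.
  intros Hf; induction N as [|N IH]; intros Hj; simpl.
  - replace j with 0%nat by lia. lra.
  - destruct (Nat.eq_dec j (S N)) as [->|Hne].
    + pose proof (cond_pos_sum f N Hf). lra.
    + specialize (IH ltac:(lia)). specialize (Hf (S N)). lra.
Qed.

(** For [1 <= x <= J] the single term [j = x - 1] of the sum of [m^j (x - j)^+] already equals
    [m^(x - 1)]. The [J] terms have expectation at most 2 each, and [1 + 2 m J <= 3 m J]. *)
Lemma mom0_of_excess m E J : (2 <= m)%nat -> (1 <= J)%nat -> expectation E -> supported J E ->
  (forall j, (j < J)%nat -> INR m ^ j * E (fun x => INR (x - j)) <= 2) ->
  mom E (INR m) 0 <= 3 * INR m * INR J.
Proof.
  intros Hm HJ HE HS H. pose proof (INR_ge2 m Hm) as HM. set (M := INR m) in *.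
  destruct J as [|J]; [lia|].
  apply Rle_trans with (E (fun x => 1 + M * sum_f_R0 (fun j => M ^ j * INR (x - j)) J)).
  - apply HS. intros x Hx. simpl (_ ^ 0). rewrite Rmult_1_l.
    assert (Hpos : forall j, 0 <= M ^ j * INR (x - j)).
    { intros j. apply Rmult_le_pos; [apply pow_le; lra | apply pos_INR]. }
    destruct x as [|x].
    + simpl pow. pose proof (cond_pos_sum _ J Hpos). nra.
    + pose proof (sum_ge_term _ J x Hpos ltac:(lia)) as Q. cbv beta in Q.
      replace (S x - x)%nat with 1%nat in Q by lia. simpl (INR 1) in Q. simpl (M ^ S x). nra.
  - rewrite (ev_add _ HE), (ev_one _ HE), (ev_scal _ HE), (ev_sum E _ _ HE).
    assert (Q : sum_f_R0 (fun j => E (fun x => M ^ j * INR (x - j))) J <= sum_f_R0 (fun _ => 2) J).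
    { apply sum_Rle. intros j Hj. rewrite (ev_scal _ HE). apply H; lia. }
    rewrite sum_cte in Q. assert (1 <= INR (S J)) by (rewrite S_INR; pose proof (pos_INR J); lra).
    nra.
Qed.

(* For [s < m] the correction from [(S - 1)^+] has a favourable sign, so the defect at [s]
   is multiplied by at least [m / s]; the mass cut off above [J] weighs about [(s / m)^J]. *)
Lemma blowup m E th ep J n : (2 <= m)%nat -> expectation E -> 0 < th <= / 2 -> 0 < ep ->
  (1 <= J)%nat ->
  ep <= defect m (cutE J E) (INR m * (1 - th)) ->
  (INR m - 1) * (INR m * INR J) * (1 - th) ^ J * (3 * INR m * INR J) ^ m <= th * ep / 2 ->
  3 * INR m ^ 2 * INR J ^ 2 < (1 + th / 2) ^ n * ep ->
  exists j, (j <= n + J)%nat /\ 2 <= iterE m j E INR.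
Proof.
  intros Hm HE Hth Hep HJ Hstart Hloss Hlong.
  pose proof (INR_ge2 m Hm) as HM. set (M := INR m) in *. set (s := M * (1 - th)) in *.
  assert (Hs : 1 <= s <= M) by (unfold s; nra).
  apply NNPP; intros Hno.
  assert (Hsmall : forall j, (j <= n + J)%nat -> iterE m j E INR < 2).
  { intros j Hj. apply Rnot_le_lt; intros Hge. apply Hno; eauto. }
  pose (Z := fun k => cutiterE m J k E).
  (* The excess of [Z k] over [j < J] is controlled by the mean at time [j + k], which is why the
     horizon is [n + J]. *)
  assert (HZm : forall k, (k <= n)%nat -> mom (Z k) M 0 <= 3 * M * INR J).
  { intros k Hk. destruct (cutiterE_spec m J k E HE) as (I1 & I2 & I3).
    apply mom0_of_excess; auto. intros j Hj.
    pose proof (iterE_mean m (iterE m k E) j (iterE_expectation m k E HE)) as Q.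
    rewrite <- iterE_add in Q. specialize (Hsmall (j + k)%nat ltac:(lia)).
    assert (Q2 : Z k (fun x => INR (x - j)) <= iterE m k E (fun x => INR (x - j))).
    { apply I3. intros x y Hxy. apply le_INR; lia. }
    pose proof (pow_le M j ltac:(lra)).
    apply Rle_trans with (M ^ j * iterE m k E (fun x => INR (x - j))).
    - apply Rmult_le_compat_l; auto.
    - fold M in Q. lra. }
  assert (Hgrow : forall k, (k <= n)%nat -> (1 + th / 2) ^ k * ep <= defect m (Z k) s).
  { induction k as [|k IH]; intros Hk.
    - simpl pow. rewrite Rmult_1_l. exact Hstart.
    - specialize (IH ltac:(lia)). specialize (HZm k ltac:(lia)).
      destruct (cutiterE_spec m J k E HE) as (I1 & I2 & _). fold (Z k) in I1, I2.
      change (Z (S k)) with (cutE J (stepE m (Z k))).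
      set (F := Z k) in *.
      pose proof (stepE_expectation m F I1) as HW.
      pose proof (defect_step_ge m F s Hm I1 Hs) as Hstep. fold M in Hstep.
      set (b := (M - 1) * (M * INR J) * (1 - th) ^ J).
      assert (Hb : 0 <= b).
      { unfold b. pose proof (pos_INR J). pose proof (pow_le (1 - th) J ltac:(lra)).
        apply Rmult_le_pos; [|lra]. apply Rmult_le_pos; nra. }
      (* A removed value [y = S - 1] satisfies [J < y <= m J], so its contribution is at most
         [(m - 1) m J s^y], with [s^y <= (1 - th)^J m^S]; then [E m^S] is the [m]-th power of
         [mom F M 0]. *)
      assert (Hcut : defect m (stepE m F) s - b * mom F M 0 ^ m <= defect m (cutE J (stepE m F)) s).
      { rewrite !defect_ev by auto using cutE_expectation. fold M.
        pose proof (sumE_expectation m F I1) as HS.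
        destruct (mom_step F M m Hm I1 ltac:(lra)) as (S0 & _).
        rewrite <- S0. unfold mom.
        unfold cutE, stepE.
        rewrite <- (ev_scal _ HS).
        match goal with |- ?u - ?v <= ?w => enough (u <= w + v) by lra end.
        rewrite <- (ev_add _ HS).
        apply (sumE_supported m J F I2). intros x Hx. simpl (INR x ^ 0). rewrite Rmult_1_l.
        pose proof (pow_R1_Rle M x ltac:(lra)) as Hpx.
        unfold cut. destruct (Nat.leb_spec (pred x) J) as [Hle|Hgt].
        - assert (0 <= b * M ^ x) by (apply Rmult_le_pos; lra). lra.
        - set (y := pred x) in *. change (INR 0) with 0. simpl (s ^ 0).
          assert (Hy : INR y <= M * INR J).
          { unfold M. rewrite <- mult_INR. apply le_INR. lia. }
          assert (Hsy : s ^ y <= (1 - th) ^ J * M ^ x).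
          { unfold s. rewrite Rpow_mult_distr, Rmult_comm.
            apply Rmult_le_compat; try (apply pow_le; lra).
            - replace y with (J + (y - J))%nat by lia. rewrite pow_add.
              pose proof (pow_le (1 - th) J ltac:(lra)).
              assert ((1 - th) ^ (y - J) <= 1).
              { apply Rle_trans with (1 ^ (y - J)); [apply pow_incr; lra | rewrite pow1; lra]. }
              nra.
            - apply Rle_pow; [lra|lia]. }
          pose proof (pos_INR y). pose proof (pow_R1_Rle s y ltac:(lra)).
          assert ((M - 1) * INR y * s ^ y <= b * M ^ x); [|lra].
          apply Rle_trans with ((M - 1) * (M * INR J) * ((1 - th) ^ J * M ^ x)).
          2:{ unfold b; lra. }
          apply Rmult_le_compat; try lra.
          + apply Rmult_le_pos; lra.
          + apply Rmult_le_compat_l; lra. }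
      assert (HG0 : 0 <= mom F M 0) by (pose proof (mom0_ge1 F M I1); lra).
      assert (Hloss' : b * mom F M 0 ^ m <= th * ep / 2).
      { apply Rle_trans with (2 := Hloss). apply Rmult_le_compat_l; [exact Hb|].
        apply pow_incr. lra. }
      assert (Hone : 1 <= (1 + th / 2) ^ k) by (apply pow_R1_Rle; lra).
      assert (HDep : ep <= defect m F s) by nra.
      (* The gain is [m / s = 1 / (1 - th) >= 1 + th]. The cut costs at most [th * ep / 2], hence at
         most [th / 2] times the defect, leaving [1 + th / 2]. *)
      assert (Hgain : (1 + th) * defect m F s <= defect m (stepE m F) s).
      { apply Rle_trans with (2 := Hstep). apply Rmult_le_compat_r; [lra|].
        pose proof (pow_R1_Rle _ (m - 1) (mom0_ge1 F s I1 (proj1 Hs))) as HGm.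
        assert (1 + th <= M / s).
        { apply Rmult_le_reg_r with s; [lra|]. unfold Rdiv. rewrite Rmult_assoc, Rinv_l by lra.
          unfold s. nra. }
        nra. }
      simpl pow. rewrite Rmult_assoc.
      assert (th * ep <= th * defect m F s) by (apply Rmult_le_compat_l; lra).
      assert ((1 + th / 2) * ((1 + th / 2) ^ k * ep) <= (1 + th / 2) * defect m F s)
        by (apply Rmult_le_compat_l; lra).
      lra. }
  specialize (Hgrow n (le_n n)). specialize (HZm n (le_n n)).
  destruct (cutiterE_spec m J n E HE) as (I1 & I2 & _). fold (Z n) in I1, I2.
  (* This caps the defect at [3 m^2 J^2], contradicting [Hlong]. *)
  enough (defect m (Z n) s <= M * INR J * mom (Z n) M 0).
  { assert (1 <= INR J) by (apply le_INR in HJ; exact HJ).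
    assert (M * INR J * mom (Z n) M 0 <= M * INR J * (3 * M * INR J)).
    { apply Rmult_le_compat_l; nra. }
    nra. }
  rewrite defect_ev by auto. unfold mom. rewrite <- (ev_scal _ I1).
  apply I2; intros x Hx. fold M. simpl (_ ^ 0). rewrite Rmult_1_l.
  assert (Hsx : s ^ x <= M ^ x) by (apply pow_incr; lra).
  pose proof (pow_R1_Rle s x ltac:(lra)). apply le_INR in Hx.
  pose proof (pos_INR x).
  apply Rle_trans with ((M * INR J) * s ^ x).
  - apply Rmult_le_compat_r; nra.
  - apply Rmult_le_compat_l; nra.
Qed.

(** * Choice of the tilt, the cutoff and the time horizon *)

Lemma bernoulli t x : 0 <= t <= 1 -> 1 - t * INR x <= (1 - t) ^ x.
Proof.
  intros Ht; induction x as [|x IH]; [simpl; lra|].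
  rewrite S_INR. simpl pow. pose proof (pos_INR x).
  apply Rle_trans with ((1 - t) * (1 - t * INR x)).
  - assert (0 <= t * t * INR x) by (apply Rmult_le_pos; nra). nra.
  - apply Rmult_le_compat_l; lra.
Qed.

Lemma exp_INR_mult x n : exp (INR n * x) = exp x ^ n.
Proof.
  induction n as [|n IH]; [simpl; rewrite Rmult_0_l; apply exp_0|].
  rewrite S_INR. simpl. rewrite <- IH, <- exp_plus. f_equal. ring.
Qed.

Lemma defect1_ev m E : expectation E ->
  defect1 m E = E (fun x => INR x * ((INR m - 1) * INR x - 1) * INR m ^ x).
Proof.
  intros H. unfold defect1.
  rewrite (ev_poly0 E (INR m) 0 (-1) (INR m - 1) 0 _ H); [ring | intros; ring].
Qed.

(** Lowering the base costs at most a fraction [th X], by Bernoulli. A value above [J] loses its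
    whole weight [d X m^X >= 1] and then counts [-1]; since [X / J > 1], twice [X / J] times that
    weight covers both losses. *)
Lemma defect_lower_cut m E th J : (2 <= m)%nat -> expectation E -> 0 < th <= / 2 -> (1 <= J)%nat ->
  defect m E (INR m) - (th + 2 / INR J) * defect1 m E
    <= defect m (cutE J E) (INR m * (1 - th)).
Proof.
  intros Hm HE Hth HJ. pose proof (INR_ge2 m Hm) as HM.
  rewrite !defect_ev, defect1_ev by auto using cutE_expectation. unfold cutE.
  set (M := INR m) in *. apply le_INR in HJ. simpl (INR 1) in HJ.
  match goal with |- ?u - ?v <= ?w => enough (u <= w + v) by lra end.
  rewrite <- (ev_scal _ HE), <- (ev_add _ HE). apply (ev_le _ HE). intros x.
  rewrite Rpow_mult_distr.
  pose proof (pow_R1_Rle M x ltac:(lra)) as Hp.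
  assert (HJ2 : 0 < 2 / INR J) by (apply Rdiv_lt_0_compat; lra).
  destruct x as [|x].
  - unfold cut. simpl. lra.
  - remember (S x) as y eqn:Hy.
    assert (HX : 1 <= INR y) by (subst y; rewrite S_INR; pose proof (pos_INR x); lra).
    assert (Hd : 0 <= (M - 1) * INR y - 1) by nra.
    assert (Hdp : 0 <= ((M - 1) * INR y - 1) * M ^ y) by nra.
    assert (Hdx : 0 <= INR y * ((M - 1) * INR y - 1) * M ^ y) by nra.
    unfold cut. destruct (Nat.leb_spec y J) as [Hle|Hgt].
    + pose proof (bernoulli th y ltac:(lra)) as Hb.
      assert (((M - 1) * INR y - 1) * M ^ y * (1 - th * INR y)
              <= ((M - 1) * INR y - 1) * M ^ y * (1 - th) ^ y)
        by (apply Rmult_le_compat_l; auto).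
      assert (0 <= 2 / INR J * (INR y * ((M - 1) * INR y - 1) * M ^ y))
        by (apply Rmult_le_pos; lra).
      lra.
    + apply lt_INR in Hgt. change (INR 0) with 0. simpl (_ ^ 0).
      assert (HyJ : 2 <= 2 / INR J * INR y).
      { apply Rmult_le_reg_r with (INR J); [lra|].
        replace (2 / INR J * INR y * INR J) with (2 * INR y) by (field; lra). lra. }
      assert (Hy2 : 2 <= INR y).
      { assert (H1 : INR 1 < INR y) by (simpl; lra). apply INR_lt in H1.
        apply (le_INR 2) in H1. simpl in H1. lra. }
      assert (Hd1 : 1 <= (M - 1) * INR y - 1) by nra.
      assert (Hdp1 : 1 <= ((M - 1) * INR y - 1) * M ^ y) by nra.
      replace ((th + 2 / INR J) * (INR y * ((M - 1) * INR y - 1) * M ^ y)) with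
        ((th * INR y + 2 / INR J * INR y) * (((M - 1) * INR y - 1) * M ^ y)) by ring.
      assert (0 <= th * INR y) by nra.
      assert (2 * (((M - 1) * INR y - 1) * M ^ y) <=
        (th * INR y + 2 / INR J * INR y) * (((M - 1) * INR y - 1) * M ^ y))
        by (apply Rmult_le_compat_r; lra).
      lra.
Qed.

Lemma pow_le_exp k y : 0 <= y -> y ^ S k <= (2 * INR (S k)) ^ S k * exp (y / 2).
Proof.
  intros Hy. set (K := INR (S k)).
  assert (HK : 0 < K) by (apply lt_0_INR; lia).
  replace (y / 2) with (K * (y / (2 * K))) by (field; lra).
  unfold K at 2. rewrite exp_INR_mult, <- Rpow_mult_distr. apply pow_incr. split; [lra|].
  pose proof (exp_ineq1_le (y / (2 * K))).
  apply Rle_trans with (2 * K * (y / (2 * K))).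
  - apply Req_le. field. lra.
  - apply Rmult_le_compat_l; lra.
Qed.

Lemma ln_ge1 x : 3 <= x -> 1 <= ln x.
Proof.
  intros Hx. rewrite <- (ln_exp 1). pose proof exp_le_3. pose proof (exp_pos 1).
  destruct (Req_dec (exp 1) x) as [->|]; [lra|]. left. apply ln_increasing; lra.
Qed.

Lemma ln_ge0 x : 1 <= x -> 0 <= ln x.
Proof.
  intros [H| <-]; [|rewrite ln_1; lra]. rewrite <- ln_1. left. apply ln_increasing; lra.
Qed.

Lemma ln_le_compat x y : 0 < x -> x <= y -> ln x <= ln y.
Proof. intros Hx [H| <-]; [left; now apply ln_increasing | lra]. Qed.

(** With [J] of order [tau log tau], [exp (J / tau)] is a large power of [tau]: half of the exponent
    absorbs the power of [J / tau], the other half the constant and [tau ^ (k + 2)]. *)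
Lemma cutoff_exists k W : 1 <= W ->
  exists b, 0 < b /\ forall tau, 8 <= tau ->
    exists J, 2 * tau <= INR J <= b * (tau * ln tau) /\
      W * INR J ^ S k * tau <= exp (INR J / tau).
Proof.
  intros HW. set (W' := W * (2 * INR (S k)) ^ S k).
  assert (HW' : 1 <= W').
  { unfold W'. assert (1 <= (2 * INR (S k)) ^ S k).
    { apply pow_R1_Rle. rewrite S_INR. pose proof (pos_INR k). lra. }
    nra. }
  pose proof (ln_ge0 W' HW') as HlW.
  set (b := 2 * (ln W' + INR (S (S k)))).
  assert (Hb : 2 <= b).
  { unfold b. rewrite !S_INR. pose proof (pos_INR k). lra. }
  exists (b + 1). split; [lra|]. intros tau Htau.
  assert (Hl : 1 <= ln tau) by (apply ln_ge1; lra).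
  assert (Htl : tau <= tau * ln tau) by nra.
  destruct (exists_ceil (b * (tau * ln tau))) as [J HJ]; [nra|].
  exists J. split; [split; nra|].
  set (y := INR J / tau).
  assert (HJy : INR J = y * tau) by (unfold y; field; lra).
  assert (Hy : b * ln tau <= y).
  { apply Rmult_le_reg_r with tau; [lra|]. rewrite <- HJy. lra. }
  pose proof (pow_le_exp k y ltac:(nra)) as Hpe.
  replace (exp y) with (exp (y / 2) * exp (y / 2)) by (rewrite <- exp_plus; f_equal; field).
  rewrite HJy, Rpow_mult_distr.
  pose proof (exp_pos (y / 2)).
  assert (Ht1 : W' * tau ^ S (S k) <= exp (y / 2)).
  { rewrite <- (exp_ln W') by lra.
    rewrite <- (exp_ln tau) at 1 by lra. rewrite <- exp_INR_mult, <- exp_plus.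
    assert (Hle : ln W' + INR (S (S k)) * ln tau <= y / 2).
    { unfold b in Hy. nra. }
    destruct Hle as [Hlt| ->]; [left; now apply exp_increasing | lra]. }
  assert (Ht0 : 0 < tau ^ S (S k)) by (apply pow_lt; lra).
  apply Rle_trans with (W * tau ^ S (S k) * ((2 * INR (S k)) ^ S k * exp (y / 2))).
  - replace (W * (y ^ S k * tau ^ S k) * tau) with (W * tau ^ S (S k) * y ^ S k) by (simpl; ring).
    apply Rmult_le_compat_l; [nra|exact Hpe].
  - replace (W * tau ^ S (S k) * ((2 * INR (S k)) ^ S k * exp (y / 2))) with
      (W' * tau ^ S (S k) * exp (y / 2)) by (unfold W'; ring).
    apply Rmult_le_compat_r; lra.
Qed.

(** [escape] brings [D] to constant order within [K + 1] steps; [blowup] then needs a number of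
    steps of order [K log K]. *)
Lemma supercritical_time m : (2 <= m)%nat -> exists c, 0 < c /\
  forall E K, expectation E -> 1 <= K ->
    0 < defect m E (INR m) -> 1 <= K ^ 2 * defect m E (INR m) ->
    defect2 m E <= K ^ 2 * defect m E (INR m) ->
    exists j, INR j <= c * (K * (1 + ln K)) /\ 2 <= iterE m j E INR.
Proof.
  intros Hm. pose proof (INR_ge2 m Hm) as HM. set (M := INR m) in *.
  pose proof (rate_bounds m Hm) as Hrate.
  set (e0 := rate m ^ 2).
  assert (He0 : 0 < e0 <= 1) by (unfold e0; split; [apply pow_lt; lra | nra]).
  assert (Hsp : 1 <= spread m) by (unfold spread, drift; fold M; nra).
  set (a := 2 * spread m / e0).
  assert (Ha : 2 <= a).
  { unfold a. apply Rmult_le_reg_r with e0; [lra|]. unfold Rdiv.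
    rewrite Rmult_assoc, Rinv_l by lra. nra. }
  (* Collects the constants of the loss condition in [blowup] with [ep = e0 / 2]; the power of [J]
     there is [m + 1]. *)
  set (W := (M - 1) * M * (3 * M) ^ m * (4 / e0)).
  assert (H3M : 9 * M ^ 2 <= (3 * M) ^ m).
  { replace (9 * M ^ 2) with ((3 * M) ^ 2) by ring. apply Rle_pow; [lra|lia]. }
  assert (He4 : 4 <= 4 / e0).
  { apply Rmult_le_reg_r with e0; [lra|]. unfold Rdiv. rewrite Rmult_assoc, Rinv_l by lra. lra. }
  assert (HMM : 2 <= (M - 1) * M) by nra.
  assert (HM2 : 4 <= M ^ 2) by nra.
  assert (HMMM : 18 * M ^ 2 <= (M - 1) * M * (3 * M) ^ m).
  { apply Rle_trans with (2 * (9 * M ^ 2)); [lra|]. apply Rmult_le_compat; lra. }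
  assert (HW : 1 <= W) by (unfold W; nra).
  destruct (cutoff_exists m W HW) as (b & Hb & Hcut).
  assert (Hla : 0 <= ln (4 * a)) by (apply ln_ge0; lra).
  exists (2 + 20 * b * a * (1 + ln (4 * a))). split.
  { assert (0 < b * a) by (apply Rmult_lt_0_compat; lra).
    assert (0 <= b * a * (1 + ln (4 * a))) by (apply Rmult_le_pos; lra). lra. }
  intros E K HE HK HD0 HKD HH0.
  destruct (escape m E K Hm HE HK HD0 HKD HH0) as (n1 & Hn1 & HDn & HHn).
  pose proof (iterE_expectation m n1 E HE) as HF. set (F := iterE m n1 E) in *.
  fold M e0 in HDn, HHn. set (D := defect m F M) in *.
  assert (HaK : 2 <= a * K) by nra.
  (* With [th = 1 / tau] and [2 / J <= th], the loss [(th + 2 / J) * defect1] is at most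
     [2 th a K D = D / 2], so half of [D] survives the cut. *)
  set (tau := 4 * (a * K)).
  destruct (Hcut tau ltac:(unfold tau; lra)) as (J & [HJ1 HJ2] & HJ3).
  assert (HJ0 : 1 <= INR J) by (unfold tau in *; lra).
  assert (HJnat : (1 <= J)%nat) by (apply INR_le; simpl; lra).
  assert (HE1 : defect1 m F <= a * K * D).
  { set (r := spread m * K).
    assert (Hr : 0 < r) by (unfold r; nra).
    pose proof (defect1_le m F Hm HF r Hr) as Q. fold M D in Q. fold r in HHn.
    assert (defect2 m F / (2 * r) <= r / 2 * D).
    { apply Rmult_le_reg_r with (2 * r); [lra|].
      unfold Rdiv at 1. rewrite Rmult_assoc, Rinv_l by lra. nra. }
    assert (Q2 : defect1 m F <= r * (D + / 2)) by lra.
    apply Rle_trans with (1 := Q2).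
    replace (a * K * D) with (r * (2 * (D / e0))) by (unfold a, r; field; lra).
    apply Rmult_le_compat_l; [lra|].
    assert (1 <= D / e0).
    { apply Rmult_le_reg_r with e0; [lra|]. unfold Rdiv. rewrite Rmult_assoc, Rinv_l by lra. lra. }
    assert (D <= D / e0).
    { apply Rmult_le_reg_r with e0; [lra|]. unfold Rdiv. rewrite Rmult_assoc, Rinv_l by lra. nra. }
    lra. }
  set (th := / tau).
  assert (Hth : 0 < th <= / 2).
  { unfold th; split; [apply Rinv_0_lt_compat; unfold tau; lra|].
    apply Rinv_le_contravar; unfold tau; lra. }
  assert (Htht : th * tau = 1) by (unfold th; apply Rinv_l; unfold tau; lra).
  assert (HexpJ : exp (INR J / tau) = exp th ^ J).
  { rewrite <- exp_INR_mult. reflexivity. }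
  assert (HJpos : 0 < INR J ^ S m) by (apply pow_lt; lra).
  (* [4 * J] steps suffice because [(1 + th / 2)^4 >= exp th], so the growth is at least
     [exp (J / tau)]. *)
  destruct (blowup m F th (e0 / 2) J (4 * J) Hm HF Hth ltac:(lra) HJnat) as (j & Hj & Hj2).
  - apply Rle_trans with (2 := defect_lower_cut m F th J Hm HF Hth HJnat). fold M D.
    pose proof (defect1_ge0 m F Hm HF) as HE0.
    assert (2 / INR J <= th).
    { apply Rmult_le_reg_r with (INR J); [lra|]. unfold Rdiv.
      rewrite Rmult_assoc, Rinv_l by lra. nra. }
    assert ((th + 2 / INR J) * defect1 m F <= (2 * th) * (a * K * D)).
    { apply Rmult_le_compat; try lra. assert (0 < 2 / INR J) by (apply Rdiv_lt_0_compat; lra). lra. }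
    assert (2 * th * (a * K * D) = D / 2).
    { replace (a * K) with (tau / 4) by (unfold tau; field).
      replace (2 * th * (tau / 4 * D)) with (th * tau * D / 2) by field. rewrite Htht. lra. }
    lra.
  - fold M.
    assert (Hdec : (1 - th) ^ J * exp th ^ J <= 1).
    { rewrite <- Rpow_mult_distr. apply Rle_trans with (1 ^ J); [|rewrite pow1; lra].
      apply pow_incr. pose proof (exp_pos th). split; [apply Rmult_le_pos; lra|].
      apply Rle_trans with (exp (- th) * exp th).
      - apply Rmult_le_compat_r; [lra|]. pose proof (exp_ineq1_le (- th)). lra.
      - rewrite <- exp_plus, Rplus_opp_l, exp_0. lra. }
    rewrite HexpJ in HJ3.
    assert (Hq : 0 <= (1 - th) ^ J) by (apply pow_le; lra).
    assert (Hprod : (1 - th) ^ J * (W * INR J ^ S m * tau) <= 1).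
    { apply Rle_trans with (2 := Hdec). apply Rmult_le_compat_l; auto. }
    apply Rle_trans with ((1 - th) ^ J * (W * INR J ^ S m * tau) * (th * (e0 / 2) / 2)).
    + rewrite (Rpow_mult_distr (3 * M) (INR J) m). unfold W.
      apply Req_le.
      replace ((1 - th) ^ J * ((M - 1) * M * (3 * M) ^ m * (4 / e0) * INR J ^ S m * tau) * (th * (e0 / 2) / 2))
        with ((1 - th) ^ J * ((M - 1) * M * (3 * M) ^ m * INR J ^ S m) * (th * tau)) by (field; lra).
      rewrite Htht. simpl pow. ring.
    + assert (0 <= th * (e0 / 2) / 2) by nra. nra.
  - fold M.
    assert (Hexp4 : exp th ^ J <= (1 + th / 2) ^ (4 * J)).
    { rewrite pow_mult. apply pow_incr. pose proof (exp_pos th). split; [lra|].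
      replace th with (INR 4 * (th / 4)) at 1 by (simpl; field).
      rewrite exp_INR_mult. apply pow_incr. pose proof (exp_pos (th / 4)). split; [lra|].
      pose proof (exp_ineq1_le (- (th / 4))) as Q.
      assert (Hinv : exp (- (th / 4)) * exp (th / 4) = 1)
        by (rewrite <- exp_plus, Rplus_opp_l; apply exp_0).
      assert (1 <= (1 + th / 2) * exp (- (th / 4))).
      { apply Rle_trans with ((1 + th / 2) * (1 - th / 4)); [nra|]. apply Rmult_le_compat_l; lra. }
      nra. }
    rewrite HexpJ in HJ3.
    apply Rlt_le_trans with (W * INR J ^ S m * tau * (e0 / 2)); [|apply Rmult_le_compat_r; lra].
    assert (HJm : INR J ^ 2 <= INR J ^ S m) by (apply Rle_pow; [lra|lia]).
    replace (W * INR J ^ S m * tau * (e0 / 2)) with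
      ((M - 1) * M * (3 * M) ^ m * (2 * tau) * INR J ^ S m) by (unfold W; field; lra).
    apply Rlt_le_trans with (18 * M ^ 2 * INR J ^ 2).
    + assert (0 < M ^ 2 * INR J ^ 2) by (apply Rmult_lt_0_compat; nra). nra.
    + apply Rmult_le_compat; nra.
  - exists (j + n1)%nat. split; [|rewrite iterE_add; exact Hj2].
    apply le_INR in Hj. rewrite plus_INR, mult_INR in Hj. simpl (INR 4) in Hj.
    rewrite plus_INR.
    assert (HlK : 0 <= ln K) by (apply ln_ge0; lra).
    assert (Hlt : ln tau <= (1 + ln (4 * a)) * (1 + ln K)).
    { replace tau with (4 * a * K) by (unfold tau; ring). rewrite ln_mult by lra. nra. }
    assert (Hlt1 : tau * ln tau <= 4 * a * (1 + ln (4 * a)) * (K * (1 + ln K))).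
    { replace (4 * a * (1 + ln (4 * a)) * (K * (1 + ln K))) with
        (tau * ((1 + ln (4 * a)) * (1 + ln K))) by (unfold tau; ring).
      apply Rmult_le_compat_l; [unfold tau; lra|exact Hlt]. }
    assert (HJf : 5 * INR J <= 5 * (b * (4 * a * (1 + ln (4 * a)) * (K * (1 + ln K))))).
    { apply Rmult_le_compat_l; [lra|]. apply Rle_trans with (1 := HJ2).
      apply Rmult_le_compat_l; lra. }
    assert (INR n1 <= 2 * (K * (1 + ln K))) by nra.
    lra.
Qed.

(** * Comparison with the laws [law m p n] *)

Lemma ev_sub E f g : expectation E -> E (fun x => f x - g x) = E f - E g.
Proof.
  intros H. unfold Rminus. replace (- E g) with ((-1) * E g) by ring.
  rewrite <- (ev_scal _ H), <- (ev_add _ H). apply (ev_ext _ _ _ H); intros; ring.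
Qed.

Definition upto (N x : nat) : R := if (x <=? N)%nat then 1 else 0.

(** Comparison of distribution functions: [E] is stochastically smaller than [p]. *)
Definition covers (E : (nat -> R) -> R) (p : nat -> R) : Prop :=
  forall N, sum_f_R0 p N <= E (upto N).

Definition tight (p : nat -> R) : Prop :=
  forall e, 0 < e -> exists N, 1 - e <= sum_f_R0 p N.

Lemma sum_nonneg_mono p a b : (forall k, 0 <= p k) -> (a <= b)%nat ->
  sum_f_R0 p a <= sum_f_R0 p b.
Proof.
  intros Hp Hab; induction Hab as [|b Hab IH]; simpl; [lra|]. specialize (Hp (S b)). lra.
Qed.

Lemma sum_rev f N : sum_f_R0 f N = sum_f_R0 (fun i => f (N - i)%nat) N.
Proof.
  revert f; induction N as [|N IH]; intros f; [reflexivity|].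
  rewrite (decomp_sum f) by lia. simpl pred. rewrite IH.
  rewrite tech5, Nat.sub_diag, Rplus_comm. f_equal.
  apply sum_eq; intros i Hi. rewrite Nat.sub_succ_l by lia. reflexivity.
Qed.

Lemma conv_comm p q n : conv p q n = conv q p n.
Proof.
  unfold conv. rewrite sum_rev. apply sum_eq; intros i Hi.
  replace (n - (n - i))%nat with i by lia. ring.
Qed.

Lemma sum_conv p q N :
  sum_f_R0 (conv p q) N = sum_f_R0 (fun i => p i * sum_f_R0 q (N - i)) N.
Proof.
  induction N as [|N IH]; [reflexivity|].
  rewrite tech5, IH. unfold conv. rewrite !tech5, Nat.sub_diag. simpl (sum_f_R0 q 0).
  rewrite <- Rplus_assoc. f_equal. rewrite <- plus_sum. apply sum_eq; intros i Hi.
  rewrite Nat.sub_succ_l by lia. rewrite tech5. ring.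
Qed.

Lemma conv_nonneg p q n : (forall k, 0 <= p k) -> (forall k, 0 <= q k) -> 0 <= conv p q n.
Proof.
  intros Hp Hq. unfold conv. apply cond_pos_sum. intros; now apply Rmult_le_pos.
Qed.

Lemma convpow_nonneg j p : (forall k, 0 <= p k) -> forall k, 0 <= convpow j p k.
Proof.
  intros Hp; induction j as [|j IH]; intros k; simpl.
  - destruct k; lra.
  - now apply conv_nonneg.
Qed.

Lemma conv_tight p q : (forall k, 0 <= p k) -> (forall k, 0 <= q k) ->
  tight p -> tight q -> tight (conv p q).
Proof.
  intros Hp Hq Tp Tq e He.
  destruct (Tp (e / 2) ltac:(lra)) as [a Ha]. destruct (Tq (e / 2) ltac:(lra)) as [b Hb].
  exists (a + b)%nat. rewrite sum_conv.
  apply Rle_trans with (sum_f_R0 p a * sum_f_R0 q b).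
  - pose proof (cond_pos_sum p a Hp). pose proof (cond_pos_sum q b Hq).
    destruct (Rle_dec e 1); [|nra].
    apply Rle_trans with ((1 - e / 2) * (1 - e / 2)); [nra|].
    apply Rmult_le_compat; lra.
  - assert (Hpos : forall i, 0 <= p i * sum_f_R0 q (a + b - i)).
    { intros i. apply Rmult_le_pos; [auto | now apply cond_pos_sum]. }
    apply Rle_trans with (2 := sum_nonneg_mono _ a (a + b) Hpos ltac:(lia)).
    rewrite Rmult_comm, scal_sum. apply sum_Rle. intros i Hi.
    apply Rmult_le_compat_l; auto. apply sum_nonneg_mono; auto. lia.
Qed.

Lemma convpow_tight j p : (forall k, 0 <= p k) -> tight p -> tight (convpow j p).
Proof.
  intros Hp T; induction j as [|j IH].
  - intros e He. exists 0%nat. simpl. lra.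
  - apply conv_tight; auto. now apply convpow_nonneg.
Qed.

(** [(S - 1)^+ <= N] if and only if [S <= N + 1]. *)
Lemma sum_step m p N : sum_f_R0 (step m p) N = sum_f_R0 (convpow m p) (S N).
Proof.
  induction N as [|N IH]; [reflexivity|]. rewrite tech5, IH. reflexivity.
Qed.

Lemma law_nonneg m p n : (forall k, 0 <= p k) -> forall k, 0 <= law m p n k.
Proof.
  intros Hp; induction n as [|n IH]; auto. intros [|k]; simpl.
  - apply Rplus_le_le_0_compat; now apply convpow_nonneg.
  - now apply convpow_nonneg.
Qed.

Lemma law_tight m p n : (forall k, 0 <= p k) -> tight p -> tight (law m p n).
Proof.
  intros Hp T; induction n as [|n IH]; auto. intros e He.
  destruct (convpow_tight m _ (law_nonneg m p n Hp) IH e He) as [N HN].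
  exists N. change (law m p (S n)) with (step m (law m p n)). rewrite sum_step.
  apply Rle_trans with (1 := HN). apply sum_nonneg_mono; [|lia].
  apply convpow_nonneg. now apply law_nonneg.
Qed.

Lemma sumE_covers j E p : expectation E -> (forall k, 0 <= p k) ->
  covers E p -> covers (sumE j E) (convpow j p).
Proof.
  intros HE Hp HC; induction j as [|j IH]; intros N.
  - simpl. unfold upto; simpl. induction N; simpl in *; lra.
  - simpl convpow. set (q := convpow j p) in *.
    (* After the swap the distribution function of [p] appears inside the sum, so one copy of [p] is
       replaced by [E]; exchanging the sums then exposes the distribution function of [q]. *)
    rewrite (sum_eq _ (conv q p)) by (intros; apply conv_comm).
    rewrite sum_conv. simpl sumE.
    apply Rle_trans with (E (fun x => sum_f_R0 (fun i => q i * upto (N - i) x) N)).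
    + rewrite (ev_sum E _ _ HE). apply sum_Rle; intros i Hi. rewrite (ev_scal _ HE).
      apply Rmult_le_compat_l; [now apply convpow_nonneg | apply HC].
    + apply (ev_le _ HE). intros x.
      pose proof (sumE_expectation j E HE) as HS.
      destruct (le_lt_dec x N) as [Hx|Hx].
      * apply Rle_trans with (sumE j E (upto (N - x))).
        -- apply Rle_trans with (2 := IH (N - x)%nat).
           replace (sum_f_R0 q (N - x)) with (sum_f_R0 (fun i => q i * upto (N - x) i) N).
           ++ apply Req_le. apply sum_eq; intros i Hi. f_equal. unfold upto.
              destruct (Nat.leb_spec x (N - i)), (Nat.leb_spec i (N - x)); auto; lia.
           ++ assert (Hgen : forall a b, (a <= b)%nat ->
                sum_f_R0 (fun i => q i * upto a i) b = sum_f_R0 q a).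
              { intros a b Hab. induction Hab as [|b Hab IHab].
                - apply sum_eq; intros i Hi. unfold upto.
                  rewrite (proj2 (Nat.leb_le i a) Hi). ring.
                - rewrite tech5, IHab. unfold upto.
                  rewrite (proj2 (Nat.leb_gt (S b) a)) by lia. ring. }
              apply Hgen. lia.
        -- apply (ev_le _ HS). intros y. unfold upto.
           destruct (Nat.leb_spec y (N - x)), (Nat.leb_spec (x + y) N); try lra; lia.
      * apply Rle_trans with 0.
        -- replace 0 with (sum_f_R0 (fun _ => 0) N) by (rewrite sum_cte; ring).
           apply sum_Rle; intros i Hi. unfold upto.
           rewrite (proj2 (Nat.leb_gt x (N - i))) by lia. lra.
        -- rewrite <- (ev_const (sumE j E) 0 HS). apply (ev_le _ HS). intros y.
           unfold upto. destruct (x + y <=? N)%nat; lra.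
Qed.

Lemma iterE_covers m n E p : expectation E -> (forall k, 0 <= p k) ->
  covers E p -> covers (iterE m n E) (law m p n).
Proof.
  intros HE Hp HC; induction n as [|n IH]; auto.
  pose proof (iterE_expectation m n E HE) as HF.
  change (law m p (S n)) with (step m (law m p n)).
  change (iterE m (S n) E) with (stepE m (iterE m n E)).
  intros N. rewrite sum_step.
  apply Rle_trans with (1 := sumE_covers m _ _ HF (law_nonneg m p n Hp) IH (S N)).
  apply (ev_le _ (sumE_expectation m _ HF)). intros x. unfold upto.
  destruct (Nat.leb_spec x (S N)), (Nat.leb_spec (pred x) N); try lra; lia.
Qed.

(** * Means from distribution functions, and growth of the mean *)

Lemma sum_above x M : sum_f_R0 (fun j => 1 - upto j x) M = INR (Nat.min x (S M)).
Proof.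
  induction M as [|M IH].
  - simpl sum_f_R0. unfold upto. destruct x as [|x]; simpl; [lra|].
    destruct x; simpl; lra.
  - rewrite tech5, IH. unfold upto. destruct (Nat.leb_spec x (S M)).
    + replace (Nat.min x (S (S M))) with x by lia. replace (Nat.min x (S M)) with x by lia. ring.
    + replace (Nat.min x (S (S M))) with (S (S M)) by lia.
      replace (Nat.min x (S M)) with (S M) by lia. rewrite (S_INR (S M)). ring.
Qed.

Lemma sum_tail p n N :
  sum_f_R0 (fun k => p k * (1 - upto n k)) N =
  if (N <=? n)%nat then 0 else sum_f_R0 p N - sum_f_R0 p n.
Proof.
  induction N as [|N IH].
  - simpl. unfold upto; simpl. ring.
  - rewrite tech5, IH. unfold upto.
    destruct (Nat.leb_spec N n), (Nat.leb_spec (S N) n); try lia; simpl sum_f_R0.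
    + ring.
    + replace n with N by lia. ring.
    + ring.
Qed.

(** Sum the tails [P (X > j)] over [j <= M]. The tails of [p], truncated at [N], lose at most [e]
    each, and [e] is the gap divided by the number of terms. *)
Lemma Ege_covers E M p : expectation E -> supported M E -> covers E p ->
  (forall k, 0 <= p k) -> tight p -> Ege p INR (E INR).
Proof.
  intros HE HS HC Hp T c Hc.
  set (e := (E INR - c) / INR (S M)).
  assert (HM : 0 < INR (S M)) by (apply lt_0_INR; lia).
  assert (He : 0 < e) by (apply Rdiv_lt_0_compat; lra).
  destruct (T e He) as [N0 HN0].
  set (N := Nat.max N0 (S M)). exists N.
  assert (HN : 1 - e <= sum_f_R0 p N).
  { apply Rle_trans with (1 := HN0). apply sum_nonneg_mono; auto; lia. }
  apply Rle_trans with (sum_f_R0 (fun j => sum_f_R0 p N - sum_f_R0 p j) M).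
  - assert (E INR <= sum_f_R0 (fun j => 1 - sum_f_R0 p j) M).
    { apply Rle_trans with (E (fun x => sum_f_R0 (fun j => 1 - upto j x) M)).
      - apply HS; intros x Hx. rewrite sum_above. apply le_INR; lia.
      - rewrite (ev_sum E _ _ HE). apply sum_Rle; intros j Hj.
        apply Rle_trans with (1 - E (upto j)); [|specialize (HC j); lra].
        rewrite (ev_sub E _ _ HE), (ev_one _ HE). apply Rle_refl. }
    assert (sum_f_R0 (fun j => 1 - sum_f_R0 p j) M
            <= sum_f_R0 (fun j => (sum_f_R0 p N - sum_f_R0 p j) + e) M).
    { apply sum_Rle; intros; lra. }
    rewrite plus_sum, sum_cte in H0.
    assert (e * INR (S M) = E INR - c) by (unfold e; field; lra). lra.
  - apply Rle_trans with (sum_f_R0 (fun j => sum_f_R0 (fun k => p k * (1 - upto j k)) N) M).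
    + apply sum_Rle; intros j Hj. rewrite sum_tail.
      rewrite (proj2 (Nat.leb_gt N j)) by lia. lra.
    + clear -Hp. induction N as [|N IH].
      * simpl. replace (0 * p 0%nat) with (sum_f_R0 (fun _ => 0) M) by (rewrite sum_cte; ring).
        apply sum_Rle; intros j Hj. unfold upto; simpl. lra.
      * rewrite (sum_eq _ (fun j => sum_f_R0 (fun k => p k * (1 - upto j k)) N
                 + p (S N) * (1 - upto j (S N)))) by (intros; apply tech5).
        rewrite plus_sum, tech5. apply Rplus_le_compat; [exact IH|].
        rewrite (sum_eq _ (fun j => (1 - upto j (S N)) * p (S N))) by (intros; ring).
        rewrite <- scal_sum, sum_above, Rmult_comm. apply Rmult_le_compat_r; auto.
        apply le_INR; lia.
Qed.

(** The mean satisfies [E X_(n+1) >= m E X_n - 1], and [m (m^j + 1) - 1 >= m^(j+1) + 1]. *)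
Lemma iterE_supercritical m j E : (2 <= m)%nat -> expectation E -> 2 <= E INR ->
  INR m ^ j + 1 <= iterE m j E INR.
Proof.
  intros Hm HE H2. pose proof (INR_ge2 m Hm) as HM.
  induction j as [|j IH]; [simpl; lra|].
  pose proof (iterE_expectation m j E HE) as HF.
  change (iterE m (S j) E) with (stepE m (iterE m j E)). set (F := iterE m j E) in *.
  pose proof (sumE_expectation m F HF) as HS.
  apply Rle_trans with (INR m * F INR - 1); [simpl; nra|].
  apply Rle_trans with (sumE m F INR - 1).
  - pose proof (sumE_superadditive m F INR HF) as Q. simpl in Q.
    specialize (Q ltac:(lra) ltac:(intros; rewrite plus_INR; lra)). lra.
  - unfold stepE. unfold Rminus. rewrite <- (ev_const (sumE m F) (- (1)) HS).
    rewrite <- (ev_add _ HS). apply (ev_le _ HS). intros [|x].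
    + simpl; lra.
    + simpl Nat.pred. rewrite S_INR. lra.
Qed.

(* The mass missing from [w] sits at [0]. *)
Definition finE (w : nat -> R) (N : nat) (f : nat -> R) : R :=
  f 0%nat + sum_f_R0 (fun k => w k * (f k - f 0%nat)) N.

Lemma finE_alt w N f :
  finE w N f = f 0%nat * (1 - sum_f_R0 w N) + sum_f_R0 (fun k => w k * f k) N.
Proof.
  unfold finE. rewrite (sum_eq _ (fun k => w k * f k + w k * (- f 0%nat))) by (intros; ring).
  rewrite plus_sum. rewrite <- (scal_sum w N (- f 0%nat)). ring.
Qed.

Lemma finE_supported w N : (forall k, 0 <= w k) -> sum_f_R0 w N <= 1 -> supported N (finE w N).
Proof.
  intros Hw Hs f g Hfg. rewrite !finE_alt. apply Rplus_le_compat.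
  - apply Rmult_le_compat_r; [lra|]. apply Hfg; lia.
  - apply sum_Rle; intros k Hk. apply Rmult_le_compat_l; auto.
Qed.

Lemma finE_expectation w N : (forall k, 0 <= w k) -> sum_f_R0 w N <= 1 -> expectation (finE w N).
Proof.
  intros Hw Hs. split.
  - intros f g. unfold finE.
    rewrite (sum_eq _ (fun k => w k * (f k - f 0%nat) + w k * (g k - g 0%nat))) by (intros; ring).
    rewrite plus_sum. ring.
  - intros c f. unfold finE.
    rewrite (sum_eq _ (fun k => w k * (f k - f 0%nat) * c)) by (intros; ring).
    rewrite <- scal_sum. ring.
  - intros f g Hfg. apply (finE_supported w N); auto.
  - unfold finE. rewrite (sum_eq _ (fun _ => 0)) by (intros; ring). rewrite sum_cte. ring.
Qed.

Lemma finE_covers w N p : (forall k, 0 <= p k) -> (forall n, sum_f_R0 p n <= 1) ->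
  (forall k, w k <= p k) -> covers (finE w N) p.
Proof.
  intros Hp Hs Hwp n. unfold finE. change (upto n 0) with 1.
  assert (Q : sum_f_R0 (fun k => p k * (1 - upto n k)) N + sum_f_R0 p n <= 1).
  { rewrite sum_tail. destruct (N <=? n)%nat; [rewrite Rplus_0_l; apply Hs|].
    specialize (Hs N). lra. }
  assert (Q2 : sum_f_R0 (fun k => p k * (upto n k - 1)) N
               <= sum_f_R0 (fun k => w k * (upto n k - 1)) N).
  { apply sum_Rle; intros k _. specialize (Hwp k). unfold upto. destruct (k <=? n)%nat; lra. }
  assert (Q3 : sum_f_R0 (fun k => p k * (upto n k - 1)) N
               = - sum_f_R0 (fun k => p k * (1 - upto n k)) N).
  { rewrite (sum_eq _ (fun k => p k * (1 - upto n k) * (-1))) by (intros; ring).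
    rewrite <- scal_sum. ring. }
  lra.
Qed.

(** * The initial law *)

Lemma infinite_sum_ext f g l : (forall k, f k = g k) -> infinite_sum f l -> infinite_sum g l.
Proof.
  intros Hfg H e He. destruct (H e He) as [N HN]. exists N. intros n Hn.
  rewrite <- (sum_eq f g) by auto. now apply HN.
Qed.

Lemma infinite_sum_lin f g a b l l' : infinite_sum f l -> infinite_sum g l' ->
  infinite_sum (fun k => a * f k + b * g k) (a * l + b * l').
Proof.
  intros Hf Hg.
  assert (Q : Un_cv (fun n => a * sum_f_R0 f n + b * sum_f_R0 g n) (a * l + b * l')).
  { apply (CV_plus (fun n => a * sum_f_R0 f n) (fun n => b * sum_f_R0 g n)).
    - apply (CV_mult (fun _ => a)); [|exact Hf].
      intros e He; exists 0%nat; intros; rewrite R_dist_eq; exact He.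
    - apply (CV_mult (fun _ => b)); [|exact Hg].
      intros e He; exists 0%nat; intros; rewrite R_dist_eq; exact He. }
  intros e He. destruct (Q e He) as [N HN]. exists N. intros n Hn. specialize (HN n Hn).
  rewrite plus_sum, (sum_eq _ (fun k => f k * a)), (sum_eq (fun k => b * g k) (fun k => g k * b))
    by (intros; ring).
  rewrite <- !scal_sum. exact HN.
Qed.

Lemma infinite_sum_partial f l N : infinite_sum f l -> (forall k, 0 <= f k) -> sum_f_R0 f N <= l.
Proof. intros H Hf. now apply (sum_incr f). Qed.

Lemma infinite_sum_le f g l l' : infinite_sum f l -> infinite_sum g l' ->
  (forall k, f k <= g k) -> l <= l'.
Proof.
  intros Hf Hg Hfg. pose proof (infinite_sum_lin _ _ (-1) 1 _ _ Hf Hg) as Q.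
  assert (Hnn : forall k, 0 <= -1 * f k + 1 * g k) by (intros k; specialize (Hfg k); lra).
  pose proof (infinite_sum_partial _ _ 0 Q Hnn) as Q0. simpl in Q0. specialize (Hnn 0%nat). lra.
Qed.

Lemma infinite_sum_near f l e : infinite_sum f l -> 0 < e ->
  exists N, forall n, (N <= n)%nat -> l - e <= sum_f_R0 f n.
Proof.
  intros H He. destruct (H e He) as [N HN]. exists N. intros n Hn.
  specialize (HN n Hn). unfold Rdist in HN. apply Rabs_def2 in HN. lra.
Qed.

Lemma ln_le_sqrt z : 0 < z -> ln z <= 2 * sqrt z.
Proof.
  intros Hz. pose proof (sqrt_lt_R0 z Hz) as Hs.
  replace z with (sqrt z * sqrt z) at 1 by (apply sqrt_sqrt; lra).
  rewrite ln_mult by auto.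
  assert (ln (sqrt z) <= sqrt z); [|lra].
  rewrite <- (ln_exp (sqrt z)) at 2. apply ln_le_compat; auto.
  pose proof (exp_ineq1_le (sqrt z)). lra.
Qed.

Lemma pow_beats_log M z j : 2 <= M -> 1 <= z -> 2 * ln z <= INR j -> z <= M ^ j.
Proof.
  intros HM Hz Hj. apply Rle_trans with (2 ^ j); [|apply pow_incr; lra].
  rewrite <- (exp_ln z) by lra. rewrite <- (exp_ln 2) at 1 by lra. rewrite <- exp_INR_mult.
  pose proof ln_lt_2. pose proof (ln_ge0 z Hz).
  assert (Hle : ln z <= INR j * ln 2) by nra.
  destruct Hle as [Hlt| ->]; [left; now apply exp_increasing | lra].
Qed.

(** Adds to [Y] a scaled part of the perturbation carried by values up to [2 j]. This gives a
    finitely supported law below [X] with [D] at least [eta / 8] and [H] still controlled by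
    [Lam]. *)
Lemma initial_law m (pY pX : nat -> R) (Lam EmY EYmY EY eta : R) (j N : nat) :
  (2 <= m)%nat -> is_distr pY -> is_distr pX ->
  Eeq pY (Lam_f m) Lam ->
  Eeq pY (fun k => INR m ^ k) EmY ->
  Eeq pY (fun k => INR k * INR m ^ k) EYmY ->
  (INR m - 1) * EYmY = EmY ->
  (forall k, (1 <= k)%nat -> pX k >= pY k) ->
  Eeq pY INR EY -> 0 < eta ->
  EY + eta / 2 <= sum_f_R0 (fun k => INR k * pX k) N ->
  sum_f_R0 (fun k => pX k * INR (k - j)) N <= eta / 8 ->
  exists w N', (forall k, 0 <= w k) /\ sum_f_R0 w N' <= 1 /\ (forall k, w k <= pX k) /\
    eta / 8 <= defect m (finE w N') (INR m) /\
    defect2 m (finE w N') <= 2 * INR m * Lam + (2 * INR j + 1) ^ 2 * eta / 4.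
Proof.
  intros Hm [HY0 HY1] [HX0 HX1] HLam HEm HEY Hcrit Hdom HEY1 Heta HN Hexc.
  pose proof (INR_ge2 m Hm) as HM. set (M := INR m) in *.
  set (d := fun k => (M - 1) * INR k - 1).
  (* The added 1 makes [u] vanish at 0, where [finE] puts the missing mass; criticality reads as the
     sum of [pY k * u k] being 1. *)
  set (u := fun k => d k * M ^ k + 1).
  assert (Hu : forall k, INR k <= u k).
  { intros k. unfold u, d. revert k. apply nat_case3; simpl; try nra.
    intros x Hx _. pose proof (pow_R1_Rle M x ltac:(lra)).
    assert (INR x - 1 <= (M - 1) * INR x - 1) by nra. nra. }
  assert (Hd : forall k, (1 <= k)%nat -> 0 <= d k).
  { intros k Hk. apply le_INR in Hk. simpl in Hk. unfold d. nra. }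
  assert (Hpw : forall k, 1 <= M ^ k) by (intros k; apply pow_R1_Rle; lra).
  assert (Hsum : infinite_sum (fun k => pY k * u k) 1).
  { pose proof (infinite_sum_lin _ _ (M - 1) (-1) _ _ HEY HEm) as Q1.
    pose proof (infinite_sum_lin _ _ 1 1 _ _ Q1 HY1) as Q2.
    replace 1 with (1 * ((M - 1) * EYmY + -1 * EmY) + 1 * 1) by (rewrite Hcrit; ring).
    revert Q2. apply infinite_sum_ext. intros k. unfold u, d. fold M. ring. }
  destruct (infinite_sum_near _ _ (eta / 8) Hsum ltac:(lra)) as [N1 HN1].
  set (N' := Nat.max N N1). specialize (HN1 N' ltac:(lia)).
  (* For [k > 2 j] one has [k <= 2 (k - j)], so the larger values carry at most [eta / 4] of the
     surplus [eta / 2]. *)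
  pose (v := fun k => if ((1 <=? k)%nat && (k <=? 2 * j)%nat)%bool then pX k - pY k else 0).
  assert (Hv0 : forall k, 0 <= v k).
  { intros k. unfold v. destruct (Nat.leb_spec 1 k), (Nat.leb_spec k (2 * j)); simpl; try lra.
    specialize (Hdom k H). lra. }
  assert (HQN : eta / 4 <= sum_f_R0 (fun k => v k * INR k) N).
  { assert (QY : sum_f_R0 (fun k => INR k * pY k) N <= EY).
    { apply infinite_sum_partial; auto. intros k. apply Rmult_le_pos; auto using pos_INR. }
    assert (Q : sum_f_R0 (fun k => INR k * pX k) N <=
      sum_f_R0 (fun k => (INR k * pY k + v k * INR k) + pX k * INR (k - j) * 2) N).
    { apply sum_Rle; intros k _. unfold v.
      destruct (Nat.leb_spec 1 k) as [H1|H1], (Nat.leb_spec k (2 * j)) as [H2|H2]; simpl.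
      - pose proof (Rmult_le_pos _ _ (HX0 k) (pos_INR (k - j))). nra.
      - assert (H3 : INR k <= 2 * INR (k - j)).
        { replace 2 with (INR 2) by (simpl; lra). rewrite <- mult_INR. apply le_INR. lia. }
        pose proof (Rmult_le_compat_l _ _ _ (HX0 k) H3).
        pose proof (Rmult_le_pos _ _ (pos_INR k) (HY0 k)). lra.
      - replace k with 0%nat by lia. simpl. lra.
      - lia. }
    rewrite !plus_sum, <- scal_sum in Q. lra. }
  assert (HvI : forall k, 0 <= v k * INR k) by (intros; apply Rmult_le_pos; auto using pos_INR).
  set (Q := sum_f_R0 (fun k => v k * u k) N').
  assert (HQ : eta / 4 <= Q).
  { apply Rle_trans with (1 := HQN).
    apply Rle_trans with (1 := sum_nonneg_mono _ N N' HvI ltac:(lia)).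
    apply sum_Rle; intros k _. apply Rmult_le_compat_l; auto. }
  (* Makes the contribution of the perturbation to [D] exactly [eta / 4]; since
     [k (k + 1) <= (2 j + 1)^2], it adds at most [(2 j + 1)^2 eta / 4] to [H]. *)
  set (t := eta / 4 / Q).
  assert (HtQ : t * Q = eta / 4) by (unfold t; field; lra).
  assert (Ht : 0 <= t <= 1).
  { split; [apply Rle_mult_inv_pos; lra|]. apply Rmult_le_reg_r with Q; lra. }
  pose (w := fun k => if (k =? 0)%nat then 0 else pY k + t * v k).
  assert (Hw0 : forall k, 0 <= w k).
  { intros k. unfold w. destruct (k =? 0)%nat; [lra|].
    pose proof (Rmult_le_pos _ _ (proj1 Ht) (Hv0 k)). specialize (HY0 k). lra. }
  assert (HwX : forall k, w k <= pX k).
  { intros k. unfold w. destruct (Nat.eqb_spec k 0) as [|Hk]; [apply HX0|].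
    specialize (Hdom k ltac:(lia)).
    assert (t * v k <= 1 * (pX k - pY k)); [|lra].
    apply Rmult_le_compat; try lra; auto.
    unfold v. destruct ((1 <=? k)%nat && (k <=? 2 * j)%nat)%bool; lra. }
  assert (Hw1 : sum_f_R0 w N' <= 1).
  { apply Rle_trans with (sum_f_R0 pX N'); [apply sum_Rle; auto|].
    now apply infinite_sum_partial. }
  exists w, N'. split; [|split; [|split; [|split]]]; auto.
  - rewrite defect_ev by (apply finE_expectation; auto). unfold finE. fold M.
    rewrite (sum_eq _ (fun k => pY k * u k + v k * u k * t)).
    + rewrite plus_sum, <- scal_sum. fold Q. rewrite HtQ. simpl (INR 0). simpl (M ^ 0). lra.
    + intros k _. unfold w, u, d. destruct (Nat.eqb_spec k 0) as [->|Hk]; simpl.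
      * ring.
      * ring.
  - rewrite defect2_ev by (apply finE_expectation; auto). unfold finE. fold M.
    pose proof (pos_INR j) as Hj.
    apply Rle_trans with (0 + sum_f_R0 (fun k => Lam_f m k * pY k * (2 * M) + v k * u k * (t * (2 * INR j + 1) ^ 2)) N').
    + apply Rplus_le_compat; [simpl (INR 0); lra|].
      apply sum_Rle; intros k _. simpl (INR 0). rewrite !Rmult_0_l, Rminus_0_r.
      unfold w. destruct (Nat.eqb_spec k 0) as [->|Hk].
      * unfold Lam_f, v. simpl. lra.
      * assert (H1 : 1 <= INR k) by (apply (le_INR 1); lia).
        specialize (Hd k ltac:(lia)). specialize (Hpw k).
        fold (d k). rewrite Rmult_plus_distr_r.
        assert (HdM : 0 <= d k * M ^ k) by (apply Rmult_le_pos; lra).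
        apply Rplus_le_compat.
        -- unfold Lam_f. fold M.
           replace (INR k ^ 3 * M ^ k * pY k * (2 * M)) with
             (pY k * ((2 * INR k ^ 2) * (M * INR k) * M ^ k)) by ring.
           apply Rmult_le_compat_l; auto. apply Rmult_le_compat_r; [lra|].
           apply Rmult_le_compat; try nra. unfold d. lra.
        -- replace (v k * u k * (t * (2 * INR j + 1) ^ 2)) with
             (t * v k * ((2 * INR j + 1) ^ 2 * u k)) by ring.
           rewrite (Rmult_assoc (INR k * (INR k + 1))).
           destruct (Rle_lt_or_eq_dec 0 (v k) (Hv0 k)) as [Hpos|Hz].
           ++ apply Rmult_le_compat_l; [apply Rmult_le_pos; lra|].
              assert (Hk2 : INR k <= 2 * INR j).
              { unfold v in Hpos. destruct (Nat.leb_spec 1 k), (Nat.leb_spec k (2 * j));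
                  simpl in Hpos; try lra.
                replace 2 with (INR 2) by (simpl; lra). rewrite <- mult_INR. now apply le_INR. }
              apply Rmult_le_compat; try nra. unfold u. lra.
           ++ rewrite <- Hz. lra.
    + rewrite plus_sum, <- !scal_sum. fold Q.
      replace (t * (2 * INR j + 1) ^ 2 * Q) with (t * Q * (2 * INR j + 1) ^ 2) by ring.
      rewrite HtQ.
      assert (sum_f_R0 (fun k => Lam_f m k * pY k) N' <= Lam).
      { apply infinite_sum_partial; auto. intros k. unfold Lam_f.
        apply Rmult_le_pos; auto. apply Rmult_le_pos; apply pow_le; [apply pos_INR | fold M; lra]. }
      assert (2 * M * sum_f_R0 (fun k => Lam_f m k * pY k) N' <= 2 * M * Lam)
        by (apply Rmult_le_compat_l; lra).
      lra.
Qed.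

Lemma hitting_time m : (2 <= m)%nat -> exists c, 0 < c /\
  forall (pY pX : nat -> R) (Lam EmY EYmY EY eta R0 : R),
  is_distr pY -> is_distr pX ->
  Eeq pY (Lam_f m) Lam ->
  Eeq pY (fun k => INR m ^ k) EmY ->
  Eeq pY (fun k => INR k * INR m ^ k) EYmY ->
  (INR m - 1) * EYmY = EmY ->
  (forall k, (1 <= k)%nat -> pX k >= pY k) ->
  Eeq pY INR EY -> 0 < eta <= 1 ->
  Ege pX INR (EY + eta) ->
  1 <= INR m * Lam -> 3 <= R0 -> Lam <= R0 * eta ->
  exists E j N, expectation E /\ supported N E /\ covers E pX /\
    INR j <= c * (sqrt R0 * ln R0) /\ 2 <= iterE m j E INR.
Proof.
  intros Hm. pose proof (INR_ge2 m Hm) as HM. set (M := INR m) in *.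
  destruct (supercritical_time m Hm) as (c & Hc & Hsuper).
  (* [3888 = 8 * 486]: below, [H <= 2 m Lam + 484 <= 486 m Lam], while [D >= eta / 8]. *)
  set (A := sqrt (3888 * M)).
  assert (HA2 : A * A = 3888 * M) by (apply sqrt_sqrt; lra).
  assert (HA0 : 0 <= A) by apply sqrt_pos.
  assert (HA : 1 <= A) by nra.
  assert (HlA : 0 <= ln A) by (apply ln_ge0; lra).
  assert (HlM : 0 <= ln (16 * M)) by (apply ln_ge0; lra).
  exists (c * (A * (2 + ln A)) + (2 * ln (16 * M) + 3)).
  assert (Hc1 : 0 <= c * (A * (2 + ln A))) by (apply Rmult_le_pos; nra).
  split; [lra|].
  intros pY pX Lam EmY EYmY EY eta R0 HY HX HLam HEm HEY Hcrit Hdom HEY1 Heta HEX HML HR HLR.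
  pose proof (ln_ge1 R0 HR) as HlR.
  pose proof (sqrt_sqrt R0 ltac:(lra)) as HsR. pose proof (sqrt_pos R0) as HsR0.
  assert (HsR1 : 1 <= sqrt R0) by nra.
  assert (HS : 1 <= sqrt R0 * ln R0) by nra.
  assert (HS1 : ln R0 <= sqrt R0 * ln R0) by nra.
  pose proof HX as [HX0 HX1].
  assert (HXs : forall n, sum_f_R0 pX n <= 1) by (intros; now apply infinite_sum_partial).
  (* Once [m^j >= z], the excess bound [2 m^-j] is at most [eta / 8]. *)
  set (z := 16 / eta).
  assert (Hz : 16 <= z).
  { unfold z. apply Rmult_le_reg_r with eta; [lra|]. unfold Rdiv.
    rewrite Rmult_assoc, Rinv_l by lra. lra. }
  assert (Hze : z * eta = 16) by (unfold z; field; lra).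
  assert (HzR : z <= 16 * M * R0).
  { apply Rmult_le_reg_r with eta; [lra|]. rewrite Hze.
    assert (M * Lam <= M * (R0 * eta)) by (apply Rmult_le_compat_l; lra). lra. }
  assert (Hlz0 : 0 <= ln z) by (apply ln_ge0; lra).
  assert (Hlz : ln z <= ln (16 * M) + ln R0).
  { rewrite <- ln_mult by lra. apply ln_le_compat; lra. }
  destruct (exists_ceil (2 * ln z)) as [j Hj]; [lra|].
  assert (Hjpow : z <= M ^ j) by (apply pow_beats_log; lra).
  destruct (HEX (EY + eta / 2) ltac:(lra)) as [N HN].
  set (EX := finE pX N).
  assert (HEXe : expectation EX) by (apply finE_expectation; auto).
  (* Either the truncated [X] already reaches mean 2 at the logarithmic time [j], or its excess over
     [j] is small enough for [initial_law]. *)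
  destruct (Rle_dec 2 (iterE m j EX INR)) as [Hdone|Hlt].
  { exists EX, j, N. split; [auto|]. split; [now apply finE_supported|].
    split; [apply finE_covers; auto; intros; apply Rle_refl|]. split; [|exact Hdone].
    assert (ln (16 * M) <= ln (16 * M) * (sqrt R0 * ln R0)) by nra.
    assert (0 <= c * (A * (2 + ln A)) * (sqrt R0 * ln R0)) by (apply Rmult_le_pos; lra).
    lra. }
  pose proof (iterE_mean m EX j HEXe) as Hmean. fold M in Hmean.
  assert (Hexc : sum_f_R0 (fun k => pX k * INR (k - j)) N <= eta / 8).
  { replace (sum_f_R0 _ N) with (EX (fun x => INR (x - j))).
    2:{ unfold EX, finE. simpl (INR (0 - j)). rewrite Rplus_0_l.
        apply sum_eq; intros; ring. }
    set (q := EX (fun x => INR (x - j))) in *.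
    assert (0 <= q).
    { unfold q. rewrite <- (ev_const EX 0 HEXe). apply (ev_le _ HEXe); intros; apply pos_INR. }
    assert (z * q <= 2) by nra. nra. }
  destruct (initial_law m pY pX Lam EmY EYmY EY eta j N Hm HY HX HLam HEm HEY Hcrit Hdom
    HEY1 ltac:(lra) HN Hexc) as (w & N' & Hw0 & Hw1 & HwX & HD & HH).
  fold M in HD, HH.
  assert (Hwe : expectation (finE w N')) by (apply finE_expectation; auto).
  (* [j <= 2 ln z + 1 <= 4 sqrt z + 1] gives [2 j + 1 <= 11 sqrt z], and [121 * 16 / 4 = 484]. *)
  assert (Hj2 : (2 * INR j + 1) ^ 2 * eta / 4 <= 484).
  { pose proof (ln_le_sqrt z ltac:(lra)) as Hls.
    pose proof (sqrt_sqrt z ltac:(lra)) as Hsz. pose proof (sqrt_pos z).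
    assert (1 <= sqrt z) by nra.
    assert (Hj3 : 0 <= 2 * INR j + 1 <= 11 * sqrt z) by (pose proof (pos_INR j); lra).
    assert ((2 * INR j + 1) ^ 2 <= 121 * z).
    { replace (121 * z) with ((11 * sqrt z) ^ 2) by (rewrite <- Hsz at 2; ring).
      now apply pow_incr. }
    nra. }
  set (K := A * sqrt R0).
  assert (HK : 1 <= K) by (unfold K; nra).
  assert (HK2 : K ^ 2 = 3888 * M * R0).
  { unfold K. replace ((A * sqrt R0) ^ 2) with (A * A * (sqrt R0 * sqrt R0)) by ring.
    now rewrite HA2, HsR. }
  assert (HKD : 486 * (M * Lam) <= K ^ 2 * defect m (finE w N') M).
  { rewrite HK2. apply Rle_trans with (3888 * M * R0 * (eta / 8)).
    - assert (M * Lam <= M * (R0 * eta)) by (apply Rmult_le_compat_l; lra). lra.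
    - apply Rmult_le_compat_l; [|lra]. apply Rmult_le_pos; lra. }
  destruct (Hsuper (finE w N') K Hwe HK ltac:(fold M; lra) ltac:(fold M; lra) ltac:(fold M; lra))
    as (i & Hi & Hi2).
  exists (finE w N'), i, N'. split; [auto|]. split; [now apply finE_supported|].
  split; [now apply finE_covers|]. split; [|exact Hi2].
  apply Rle_trans with (1 := Hi).
  assert (HKl : K * (1 + ln K) <= A * (2 + ln A) * (sqrt R0 * ln R0)).
  { unfold K. rewrite ln_mult by lra.
    assert (ln (sqrt R0) <= ln R0) by (apply ln_le_compat; nra).
    replace (A * (2 + ln A) * (sqrt R0 * ln R0)) with (A * sqrt R0 * ((2 + ln A) * ln R0)) by ring.
    apply Rmult_le_compat_l; [apply Rmult_le_pos; lra|]. nra. }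
  assert (c * (K * (1 + ln K)) <= c * (A * (2 + ln A) * (sqrt R0 * ln R0)))
    by (apply Rmult_le_compat_l; lra).
  assert (0 <= (2 * ln (16 * M) + 3) * (sqrt R0 * ln R0)) by (apply Rmult_le_pos; lra).
  lra.
Qed.

(** * Conclusion for [R] and the free energy *)

Theorem theorem6p5 :
  forall (m : nat) (beta : R), (2 <= m)%nat -> 0 <= beta <= 2 ->
  exists c40 c41 : R, 0 < c40 /\ 0 < c41 /\
  forall (chi : R) (pY pX : nat -> R) (Lam EmY EYmY EY eta : R),
    0 < chi <= 1 ->
    is_distr pY ->
    (exists k, (2 <= k)%nat /\ 0 < pY k) ->
    Eeq pY (Lam_f m) Lam ->
    Eeq pY (fun k => INR m ^ k) EmY ->
    Eeq pY (fun k => INR k * INR m ^ k) EYmY ->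
    (INR m - 1) * EYmY = EmY ->
    regular m pY Lam beta chi ->
    is_distr pX ->
    (forall k, (1 <= k)%nat -> pX k >= pY k) ->
    Eeq pY INR EY ->
    0 < eta <= / (3 * (INR m - 1)) ->
    Ege pX INR (EY + eta) ->
    let Rr := Lam / (eta * chi * pY 0%nat) in
    (exists j : nat,
        (Z.of_nat j <= Int_part (c40 * bound_expr beta chi (pY 0%nat) Lam Rr))%Z /\
        Ege (law m pX j) INR 2) /\
    FE_ge m pX (exp (- (c41 * bound_expr beta chi (pY 0%nat) Lam Rr))).
Proof.
  intros m beta Hm _. pose proof (INR_ge2 m Hm) as HM.
  destruct (hitting_time m Hm) as (c & Hc & Hit).
  assert (HlM : 0 < ln (INR m)) by (rewrite <- ln_1; apply ln_increasing; lra).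
  (* [c41] turns the hitting time into a free energy bound through [m^-j = exp (- j ln m)]. *)
  exists c, (c * ln (INR m)). split; [exact Hc|]. split; [now apply Rmult_lt_0_compat|].
  intros chi pY pX Lam EmY EYmY EY eta Hchi HY Hbig HLam HEm HEYm Hcrit _ HX Hdom HEY Heta HEX Rr.
  pose proof HY as [HY0 HY1]. pose proof HX as [HX0 HX1]. set (M := INR m) in *.
  assert (HpM : forall k, 0 <= M ^ k) by (intros; apply pow_le; lra).
  assert (HEm1 : 1 <= EmY).
  { apply (infinite_sum_le _ _ _ _ HY1 HEm). intros k.
    pose proof (pow_R1_Rle M k ltac:(lra)). specialize (HY0 k). fold M. nra. }
  assert (HLam1 : EYmY <= Lam).
  { apply (infinite_sum_le _ _ _ _ HEYm HLam). intros k. unfold Lam_f. fold M.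
    apply Rmult_le_compat_r; auto. apply Rmult_le_compat_r; auto. destruct k as [|k]; [simpl; lra|].
    assert (1 <= INR (S k)) by (rewrite S_INR; pose proof (pos_INR k); lra).
    set (x := INR (S k)) in *. assert (1 <= x * x) by nra. simpl. nra. }
  assert (HML : 1 <= (M - 1) * Lam) by nra.
  assert (HLampos : 0 < Lam) by nra.
  assert (HP1 : pY 0%nat <= 1) by (apply (infinite_sum_partial pY 1 0); auto).
  (* Otherwise all terms of the critical identity are nonnegative, and the one at a charged [k >= 2]
     is positive. *)
  assert (HP0 : 0 < pY 0%nat).
  { destruct (HY0 0%nat) as [|Hz]; [auto|exfalso].
    pose proof (infinite_sum_lin _ _ (M - 1) (-1) _ _ HEYm HEm) as Q.
    replace ((M - 1) * EYmY + -1 * EmY) with 0 in Q by (rewrite Hcrit; ring).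
    destruct Hbig as (k & Hk & Hpk).
    assert (Hnn : forall i, 0 <= (M - 1) * (INR i * M ^ i * pY i) + -1 * (M ^ i * pY i)).
    { intros i. destruct i as [|i]; [rewrite <- Hz; simpl; lra|].
      replace (_ + _) with (((M - 1) * INR (S i) - 1) * (M ^ S i * pY (S i))) by ring.
      apply Rmult_le_pos; [|now apply Rmult_le_pos].
      rewrite S_INR. pose proof (pos_INR i). nra. }
    pose proof (infinite_sum_partial _ _ k Q Hnn) as Q1.
    pose proof (sum_ge_term _ k k Hnn (le_n k)) as Q2. cbv beta in Q2.
    assert (0 < M ^ k * pY k) by (apply Rmult_lt_0_compat; [apply pow_lt; lra | auto]).
    apply (le_INR 2) in Hk. simpl in Hk.
    assert (1 <= (M - 1) * INR k - 1) by nra. nra. }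
  assert (Heta1 : 3 * (M - 1) * eta <= 1).
  { destruct Heta as [_ Heta]. apply Rmult_le_compat_l with (r := 3 * (M - 1)) in Heta; [|lra].
    rewrite Rinv_r in Heta by lra. exact Heta. }
  set (P0 := pY 0%nat) in *.
  assert (Hcp : 0 < chi * P0 <= 1) by (split; [apply Rmult_lt_0_compat; lra | nra]).
  assert (HRr : Rr * (eta * chi * P0) = Lam).
  { unfold Rr. field. repeat split; lra. }
  assert (HRpos : 0 < Rr).
  { unfold Rr. apply Rdiv_lt_0_compat; auto. rewrite Rmult_assoc. apply Rmult_lt_0_compat; lra. }
  assert (HLR : Lam <= Rr * eta).
  { rewrite <- HRr at 1. assert (0 < Rr * eta) by (apply Rmult_lt_0_compat; lra). nra. }
  (* Criticality gives [(m - 1) Lam >= 1], and the upper bound on [eta] turns [Lam / eta] into at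
     least 3. *)
  assert (HR3 : 3 <= Rr).
  { assert (1 <= (M - 1) * (Rr * eta)) by nra.
    assert (3 <= Rr * (3 * (M - 1) * eta)) by lra. nra. }
  destruct (Hit pY pX Lam EmY EYmY EY eta Rr) as (E & j & N & HE & HS & HC & Hj & Hj2); auto.
  { split; [lra|]. nra. }
  { fold M. lra. }
  set (be := bound_expr beta chi P0 Lam Rr).
  (* The prefactor is at least 1, the second entry of the maximum is at least [sqrt Rr], and
     [ln Rr >= 1]. *)
  assert (Hbe : sqrt Rr * ln Rr <= be).
  { unfold be, bound_expr. pose proof (ln_ge1 Rr HR3) as Hl.
    apply Rmult_le_compat_r; [lra|].
    set (s := sqrt (chi ^ 3 * P0)).
    assert (Hs : 0 < s <= 1).
    { assert (Hc3 : 0 < chi ^ 3 <= 1).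
      { split; [apply pow_lt; lra|]. apply Rle_trans with (1 ^ 3); [apply pow_incr; lra | lra]. }
      unfold s. split; [apply sqrt_lt_R0; nra|]. rewrite <- sqrt_1. apply sqrt_le_1_alt. nra. }
    assert (Hs1 : 1 <= / s) by (rewrite <- Rinv_1; apply Rinv_le_contravar; lra).
    assert (Hq : sqrt Rr <= sqrt (Rr * ln Rr)) by (apply sqrt_le_1_alt; nra).
    pose proof (sqrt_pos Rr).
    pose proof (Rmax_r (Lam * Rpower (Rr * ln Rr) ((1 - beta) / 2)) (sqrt (Rr * ln Rr))). nra. }
  assert (Hjbe : INR j <= c * be).
  { apply Rle_trans with (1 := Hj). apply Rmult_le_compat_l; lra. }
  assert (HT : tight pX).
  { intros e He. destruct (infinite_sum_near _ _ e HX1 He) as [n Hn]. exists n. now apply Hn. }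
  assert (Hlaw : forall n r, r <= iterE m n E INR -> Ege (law m pX n) INR r).
  { intros n r Hr c' Hc'. destruct (iterE_supported m n N E HS) as [N' HN'].
    apply (Ege_covers (iterE m n E) N' (law m pX n)); try lra; auto.
    - now apply iterE_expectation.
    - now apply iterE_covers.
    - now apply law_nonneg.
    - now apply law_tight. }
  split.
  - exists j. split; [|now apply Hlaw].
    destruct (archimed (c * be)) as [Hup _]. unfold Int_part.
    enough (Z.of_nat j < up (c * be))%Z by lia.
    apply lt_IZR. rewrite <- INR_IZR_INZ. lra.
  (* From the hitting time on, [E X_n >= m^(n - j)], so the free energy is at least [m^-j]. *)
  - intros c' Hc'. exists j. intros n Hn. apply Hlaw.
    replace n with ((n - j) + j)%nat by lia. rewrite iterE_add, pow_add.
    pose proof (iterE_supercritical m (n - j) _ Hm (iterE_expectation m j E HE) Hj2) as Hgr.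
    fold M in Hgr. fold M. set (i := (n - j)%nat) in *.
    assert (HMi : 0 < M ^ i) by (apply pow_lt; lra).
    assert (Hc1 : c' * M ^ j <= 1).
    { assert (HMj : M ^ j = exp (INR j * ln M)) by (rewrite exp_INR_mult, exp_ln by lra; reflexivity).
      assert (Hexp : exp (- (c * ln M * be)) * exp (INR j * ln M) <= 1).
      { rewrite <- exp_plus, <- exp_0.
        assert (Hle : - (c * ln M * be) + INR j * ln M <= 0) by nra.
        destruct Hle as [Hlt| ->]; [left; now apply exp_increasing | lra]. }
      rewrite HMj. pose proof (exp_pos (INR j * ln M)). nra. }
    replace (c' * (M ^ i * M ^ j)) with (c' * M ^ j * M ^ i) by ring. nra.
Qed.
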